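(* Let $k\ge 1$ be an integer. For every equivalence relation $\sim$ on $\mathrm{FIN}_k$ there is a $k$-block sequence $B$ which is a system of staircases (sos) such that the restriction of $\sim$ to $\langle B\rangle$ is a staircase equivalence relation in $B$.
   Context: Basic notions. $\mathbb N$ is the set of non-negative integers. For $i\ge 1$, $\mathrm{FIN}_i$ is the set of functions $s:\mathbb N\to\{0,\dots,i\}$ (called $i$-vectors) with finite support $\mathrm{supp}\,s=\{n:s(n)\ne 0\}$ and with $i$ in the range. $s<t$ means $\max\mathrm{supp}\,s<\min\mathrm{supp}\,t$; $(s\vee t)(n)=\max\{s(n),t(n)\}$, $(s\wedge t)(n)=\min\{s(n),t(n)\}$; $(T^js)(n)=\max\{s(n)-j,0\}$. A $k$-block sequence is an infinite sequence $A=(a_n)_n$ in $\mathrm{FIN}_k$ with $a_n<a_{n+1}$ for all $n$. $\langle A\rangle$ is the set of all $T^{i_0}a_{n_0}\vee\dots\vee T^{i_m}a_{n_m}$ with $n_0<\dots<n_m$, $i_j\in\{0,\dots,k\}$ and $i_j=0$ for at least one $j$. Systems of staircases. Write $\min_i a=\min a^{-1}\{i\}$, $\max_i a=\max a^{-1}\{i\}$. A $k$-vector $a$ is an sos if: (1) its range is $\{0,\dots,k\}$; (2) $\min_i a<\min_j a<\max_j a<\max_i a$ for $1\le i<j\le k$; (3) for $2\le i\le k$ the range of $a$ on each of the open intervals $(\min_{i-1}a,\min_i a)$ and $(\max_i a,\max_{i-1}a)$ is $\{0,\dots,i-1\}$, and the range of $a$ on the open interval $(\min_k a,\max_k a)$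 is $\{0,\dots,k\}$. A $k$-block sequence $A$ is an sos if every vector of $\langle A\rangle$ is an sos. Staircase relations. To $s\in\mathrm{FIN}_k$ associate the following functions $\mathbb N\to\{0,\dots,k\}$ (each is the zero function when the positions involved do not exist): $\min_i(s)$ (resp. $\max_i(s)$), $1\le i\le k$, has value $i$ at the least (resp. largest) $n$ with $s(n)=i$ and $0$ elsewhere; for $2\le i\le k$, $1\le l\le i-1$, $\theta^0_{i,l}(s)$ (resp. $\theta^1_{i,l}(s)$) has value $l$ at those $n$ in the open interval $(\min_{i-1}s,\min_i s)$ (resp. $(\max_i s,\max_{i-1}s)$) with $s(n)=l$ and $0$ elsewhere; for $1\le l\le k$, $\theta^2_l(s)$ has value $l$ at those $n\in(\min_k s,\max_k s)$ with $s(n)=l$ and $0$ elsewhere. Let $\mathcal F$ be the family of all these mappings together with the constant zero mapping. A staircase function in $A$ is a mapping on $\langle A\rangle$ belonging to the closure of $\mathcal F$ under pointwise $\vee$ and $\wedge$. A staircase equivalence relation in $A$ is a relation on $\langle A\rangle$ of the form $s\sim t\iff f(s)=f(t)$ with $f$ a staircase function. *)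

(* Defs.v *)
From mathcomp Require Import all_boot all_order.
From mathcomp Require Import boolp classical_sets functions cardinality.

Set Implicit Arguments.
Unset Strict Implicit.
Unset Printing Implicit Defensive.

Local Open Scope nat_scope.
Local Open Scope classical_set_scope.

(* The vectors of FIN_k are represented by plain functions nat -> nat; the      *)
(* bound k on the values is part of the membership condition FIN k.             *)
Definition vec := nat -> nat.

(* Junk value 0 if P has no least (resp. greatest) element.                     *)
Definition minset (P : set nat) : nat := xget 0 (P `&` lbound P).
Definition maxset (P : set nat) : nat := xget 0 (P `&` ubound P).

Definition supp (s : vec) : set nat := [set n | s n <> 0].

Definition FIN (k : nat) : set vec :=
  [set s | [/\ forall n, s n <= k, finite_set (supp s) & range s k]].

Definition vec_lt (s t : vec) : Prop := maxset (supp s) < minset (supp t).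

Definition vjoin (s t : vec) : vec := fun n => maxn (s n) (t n).
Definition vmeet (s t : vec) : vec := fun n => minn (s n) (t n).

Definition tetris (j : nat) (s : vec) : vec := fun n => s n - j.

Definition block_seq (k : nat) (A : nat -> vec) : Prop :=
  forall n, FIN k (A n) /\ vec_lt (A n) (A n.+1).

(* The combination T^{i_0} a_{n_0} \/ ... \/ T^{i_m} a_{n_m} is encoded by the  *)
(* list of pairs (n_0, i_0), ..., (n_m, i_m).                                   *)
Definition combination (A : nat -> vec) (e : seq (nat * nat)) : vec :=
  fun x => \max_(p <- e) tetris p.2 (A p.1) x.

Definition span (k : nat) (A : nat -> vec) : set vec :=
  [set s | exists e : seq (nat * nat),
    [/\ sorted ltn [seq p.1 | p <- e],
        all (fun p => p.2 <= k) e,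
        has (fun p => p.2 == 0) e
      & s = combination A e]].

Definition minat (i : nat) (a : vec) : nat := minset (a @^-1` [set i]).
Definition maxat (i : nat) (a : vec) : nat := maxset (a @^-1` [set i]).

Definition range_between (a : vec) (p q : nat) : set nat :=
  a @` [set n | p < n < q].

Definition sos (k : nat) (a : vec) : Prop :=
  [/\ range a = [set m | m <= k],
      forall i j, 1 <= i -> i < j -> j <= k ->
        [/\ minat i a < minat j a, minat j a < maxat j a
          & maxat j a < maxat i a],
      forall i, 2 <= i -> i <= k ->
        range_between a (minat i.-1 a) (minat i a) = [set m | m <= i.-1] /\
        range_between a (maxat i a) (maxat i.-1 a) = [set m | m <= i.-1]
    & range_between a (minat k a) (maxat k a) = [set m | m <= k]].

Definition sos_seq (k : nat) (A : nat -> vec) : Prop :=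
  forall a, span k A a -> sos k a.

Definition level_on (l : nat) (s : vec) (P : set nat) : vec :=
  fun n => if `[< P n /\ s n = l >] then l else 0.

(* For s in FIN_k and 1 <= i, min_i s and max_i s exist iff i is in the range   *)
(* of s; otherwise minmap and maxmap give the zero function, since then         *)
(* s n = i never holds.                                                         *)
Definition minmap (i : nat) (s : vec) : vec := level_on i s [set minat i s].
Definition maxmap (i : nat) (s : vec) : vec := level_on i s [set maxat i s].

Definition theta0 (i l : nat) (s : vec) : vec :=
  level_on l s [set n | [/\ range s i.-1, range s i
                          & minat i.-1 s < n < minat i s]].

Definition theta1 (i l : nat) (s : vec) : vec :=
  level_on l s [set n | [/\ range s i.-1, range s i
                          & maxat i s < n < maxat i.-1 s]].

Definition theta2 (k l : nat) (s : vec) : vec :=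
  level_on l s [set n | range s k /\ minat k s < n < maxat k s].

Inductive basic_map (k : nat) : (vec -> vec) -> Prop :=
| basic_zero : basic_map k (fun _ _ => 0)
| basic_min i : 1 <= i -> i <= k -> basic_map k (minmap i)
| basic_max i : 1 <= i -> i <= k -> basic_map k (maxmap i)
| basic_theta0 i l : 2 <= i -> i <= k -> 1 <= l -> l <= i.-1 ->
    basic_map k (theta0 i l)
| basic_theta1 i l : 2 <= i -> i <= k -> 1 <= l -> l <= i.-1 ->
    basic_map k (theta1 i l)
| basic_theta2 l : 1 <= l -> l <= k -> basic_map k (theta2 k l).

Inductive lattice_closure (F : (vec -> vec) -> Prop) : (vec -> vec) -> Prop :=
| closure_base f : F f -> lattice_closure F f
| closure_join f g : lattice_closure F f -> lattice_closure F g ->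
    lattice_closure F (fun s => vjoin (f s) (g s))
| closure_meet f g : lattice_closure F f -> lattice_closure F g ->
    lattice_closure F (fun s => vmeet (f s) (g s)).

(* Only the values of f on <A> matter.                                          *)
Definition staircase_fun (k : nat) (A : nat -> vec) (f : vec -> vec) : Prop :=
  exists2 g, lattice_closure (basic_map k) g
           & forall s, span k A s -> f s = g s.

(* The restriction of R to <A> is a staircase equivalence relation in A.        *)
Definition staircase_rel (k : nat) (A : nat -> vec) (R : vec -> vec -> Prop)
  : Prop :=
  exists2 f, staircase_fun k A f
           & forall s t, span k A s -> span k A t -> (R s t <-> f s = f t).

Definition equivalence_on (D : set vec) (R : vec -> vec -> Prop) : Prop :=
  [/\ forall s, D s -> R s s,
      forall s t, D s -> D t -> R s t -> R t s
    & forall s t u, D s -> D t -> D u -> R s t -> R t u -> R s u].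

(* Main.v *)
(* Work with a Gowers ultrafilter U on FIN_k, one with T^d U * U = U = U * T^d U
   for all d, and read "for U-almost all x" as "for generic x".  For levels a, b
   whose maximum is k, call the letter e negligible between a and b if for
   generic x, y, z the combination of x, y, z at the levels a, e, b is
   R-equivalent to that of x, z at the levels a, b.  The negligible letters form
   an initial segment, with end thr a b.  Fusion gives a block sequence b_n that
   behaves generically.  A vector of <b> is a word in the levels 0, ..., k, and
   deleting a letter which is negligible between the levels to its left and to
   its right does not change the R-class.  Two fully reduced words are
   R-equivalent only if they are equal or differ in the place of a single letter
   k (siblings): generic insertions next to letters p, q in the same place of two
   equivalent words show that p - q is the difference of the thresholds of the
   levels to their left, so that the words agree letter by letter from the left.
   On the other side, the map keeping s n exactly if
   thr (max of s before n) (max of s after n) <= s n is invariant under deletions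
   and separates reduced words up to siblings.  As every vector of <b> is an sos,
   this map is a join of staircase maps. *)

Require Import Defs.
From mathcomp Require Import all_boot all_order.
From mathcomp Require Import boolp classical_sets functions cardinality filter.
From mathcomp Require Import zify.

Set Implicit Arguments.
Unset Strict Implicit.
Unset Printing Implicit Defensive.

Local Open Scope nat_scope.
Local Open Scope classical_set_scope.

(** * Idempotent ultrafilters *)

(** Fusion settles only finitely many questions about each new block, while two words to be compared
    have tails of any length. The remedy is absorption: next to a generic letter at levels (p, q) of
    the two words one may insert (p - d, q - d) for any d, so neighbouring pairs with equal p - q
    merge and a tail condenses to boundedly many pairs. Letting d vary until the inserted letters
    cease to be negligible reads off the thresholds of both words at once. One of the two levels
    around a deleted letter has to be k, since otherwise the shortened word could leave FIN_k.
    Raising the other level by a negligible letter does not alter the threshold; this persistence is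
    what allows it to be read off the running maxima at single positions, even inside a block.
    Siblings are the price of staying in FIN_k: a letter k may be negligible beside another k and
    yet cannot be deleted when it is the only one. *)

Section IdempotentUltrafilters.
Variables (T : Type) (op : T -> T -> T).
Hypothesis opA : associative op.

(** For ultrafilters this is the product in the Stone-Cech compactification. Filters are allowed
    because they encode closed sets of ultrafilters, which have to be multiplied as well. *)
Definition fprod (F G : set_system T) : set_system T :=
  [set A | F [set x | G [set y | A (op x y)]]].

Lemma fprod_filter (F G : set_system T) : Filter F -> Filter G -> Filter (fprod F G).
Proof.
move=> FF FG; split.
- by apply: (@filterE _ F) => x; apply: filterE.
- by move=> A B; apply: (@filterS2 _ F) => x; apply: filterS2 => y.
- by move=> A B AB; apply: (@filterS _ F) => x; apply: filterS => y; apply: AB.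
Qed.
#[local] Existing Instance fprod_filter.

Lemma fprod_proper (F G : set_system T) :
  ProperFilter F -> ProperFilter G -> ProperFilter (fprod F G).
Proof.
move=> FF FG; apply: Build_ProperFilter_ex.
by move=> A /(@filter_ex _ F) [x /filter_ex [y Axy]]; exists (op x y).
Qed.
#[local] Existing Instance fprod_proper.

Lemma fprodA (F G H : set_system T) :
  fprod F (fprod G H) = fprod (fprod F G) H.
Proof.
apply/funext => A; rewrite /fprod /=; congr (F _); apply/funext => x.
congr (G _); apply/funext => y; congr (H _); apply/funext => z /=.
by rewrite opA.
Qed.

Lemma fprodS (F F' G G' : set_system T) : Filter F' ->
  F `<=` F' -> G `<=` G' -> fprod F G `<=` fprod F' G'.
Proof.
by move=> fF' FF' GG' A /= /FF'; apply: filterS => x; apply: GG'.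
Qed.

Definition subidem (F : set_system T) := F `<=` fprod F F.

(** Inclusion of filters reverses inclusion of closed sets, so this yields a minimal closed
    subsemigroup inside a given one. *)
Lemma maximal_subidem (G0 : set_system T) : ProperFilter G0 -> subidem G0 ->
  exists F, [/\ ProperFilter F, G0 `<=` F, subidem F &
    forall G, ProperFilter G -> subidem G -> F `<=` G -> G = F].
Proof.
move=> pG0 iG0.
pose P (F : set_system T) :=
  F = set0 \/ [/\ ProperFilter F, G0 `<=` F & subidem F].
have PG0 : P G0 by right; split.
have [] := @Zorn_bigcup _ P.
  move=> C CP tot; have [[F [CF F0]]|nF] :=
      pselect (exists F, C F /\ F <> set0); last first.
    left; apply/seteqP; split=> // A [F CF FA].
    by apply: nF; exists F; split=> // F0; rewrite F0 in FA.
  have good G A : C G -> G A -> [/\ ProperFilter G, G0 `<=` G & subidem G].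
    by move=> CG GA; have [G0'|//] := CP _ CG; rewrite G0' in GA.
  right; split.
  - apply: Build_ProperFilter_ex.
      by move=> A [G CG GA]; have [pG _ _] := good _ _ CG GA; apply: filter_ex GA.
    split.
    + have [//|[pF _ _]] := CP _ CF; exists F => //; exact: filterT.
    + move=> A B [G CG GA] [H CH HB].
      have [pG _ _] := good _ _ CG GA; have [pH _ _] := good _ _ CH HB.
      have [GH|HG] := tot _ _ CG CH.
        by exists H => //; apply: filterI => //; apply: GH.
      by exists G => //; apply: filterI => //; apply: HG.
    + move=> A B AB [G CG GA]; exists G => //.
      by have [pG _ _] := good _ _ CG GA; exact: (filterS AB GA).
  - by have [//|[_ G0F _]] := CP _ CF; move=> A /G0F FA; exists F.
  - move=> A [G CG GA]; exists G => //.
    have [pG _ iG] := good _ _ CG GA; by apply: (@filterS _ G) (iG _ GA) => x GA'; exists G.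
move=> F [PF maxF]; exists F.
have F0 : F <> set0.
  move=> F0; apply: (maxF G0) => //; rewrite F0; split=> // GT0.
  exact: (GT0 setT filterT).
have [//|[pF G0F iF]] := PF; split=> // G pG iG FG.
apply/seteqP; split=> //; apply: contrapT => nGF.
by apply: (maxF G) => //; right; split=> // A /G0F /FG.
Qed.

(* Corresponds to the closed set of the ultrafilters x above F with x * p above q. *)
Definition fquot (F p q : set_system T) : set_system T :=
  [set C | exists B A,
    [/\ F B, q A & B `&` [set x | p [set y | A (op x y)]] `<=` C]].

Lemma sub_fquot (F p q : set_system T) : Filter q -> F `<=` fquot F p q.
Proof.
by move=> fq B FB; exists B, setT; split; [by []|exact: filterT|by move=> x []].
Qed.

Lemma sub_fprod_fquot (F p q : set_system T) :
  Filter F -> q `<=` fprod (fquot F p q) p.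
Proof.
by move=> fF A qA; exists setT, A; split; [exact: filterT|by []|by move=> x []].
Qed.

(** This is compactness: right multiplication by the ultrafilter p is continuous, so the products x
    * p with x above [F] form the closed set of [fprod op F p], and any q above that filter meets
    it. *)
Lemma fquot_proper (F p q : set_system T) : ProperFilter F -> UltraFilter p ->
  ProperFilter q -> fprod F p `<=` q -> ProperFilter (fquot F p q).
Proof.
move=> pF up pq Fpq; apply: Build_ProperFilter_ex.
  move=> C [B [A [FB qA BAC]]].
  suff [x Bx] : exists x, (B `&` [set x | p [set y | A (op x y)]]) x.
    by exists x; apply: BAC.
  apply: contrapT => nex; have : fprod F p (~` A).
    apply: (@filterS _ F _ B _ _ FB) => x Bx.
    have [Aq|//] := in_ultra_setVsetC [set y | A (op x y)] up.
    by exfalso; apply: nex; exists x.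
  by move=> /Fpq /(filterI qA); rewrite setICr; exact: filter_not_empty.
split.
- by apply: sub_fquot; exact: filterT.
- move=> C C' [B [A [FB qA BAC]]] [B' [A' [FB' qA' BAC']]].
  exists (B `&` B'), (A `&` A'); split; [exact: filterI|exact: filterI|].
  move=> x [[Bx B'x] qx]; split; [apply: BAC|apply: BAC']; split=> //.
    by apply: (@filterS _ p _ _ _ _ qx) => y [].
  by apply: (@filterS _ p _ _ _ _ qx) => y [].
- move=> C C' CC' [B [A [FB qA BAC]]]; exists B, A; split=> //.
  exact: subset_trans CC'.
Qed.

(* A filter below its own square plays the role of a closed subsemigroup of the *)
(* semigroup of ultrafilters, and this is the Ellis-Numakura argument.          *)
Lemma idempotent_ultrafilter (G0 : set_system T) :
  ProperFilter G0 -> subidem G0 ->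
  exists U, [/\ UltraFilter U, G0 `<=` U & fprod U U = U].
Proof.
move=> pG0 iG0; have [F [pF G0F iF maxF]] := maximal_subidem pG0 iG0.
have [p [up Fp]] := ultraFilterLemma pF.
have pp : ProperFilter p by exact _.
(* If X is the minimal closed subsemigroup given by [F], this is X * p = X, since X * p is a closed
   subsemigroup inside X. *)
have FpF : fprod F p = F.
  apply: maxF.
    rewrite /subidem; apply: (@subset_trans _ (fprod F (fprod F p))).
      rewrite fprodA; exact: fprodS.
    by apply: fprodS => //; apply: (subset_trans iF); apply: fprodS.
  by apply: (subset_trans iF); apply: fprodS.
pose H := fquot F p p.
have pH : ProperFilter H by apply: (fquot_proper pF up pp); rewrite FpF.
have FH : F `<=` H by exact: sub_fquot.
have qH A : p A -> H [set x | p [set y | A (op x y)]].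
  exact: (@sub_fprod_fquot F p p _ A).
(* The x in X with x * p = p again form a closed subsemigroup, nonempty by [pH]. By minimality it is
   all of X and contains p. *)
have HF : H = F.
  apply: maxF => // C [B [A [FB pA BAC]]].
  have fH := @filter_filter _ _ pH; have fHH := fprod_filter fH fH.
  apply: filterS BAC _; apply: filterI.
    by have /iF := FB; apply: fprodS.
  have := qH _ pA; rewrite /fprod /=; apply: filterS => x /= /qH.
  by apply: filterS => y /=; apply: filterS => z /=; rewrite opA.
have ip : subidem p.
  by move=> A /qH; rewrite HF => /Fp; apply: filterS.
have pF' : p = F by apply: maxF.
by exists p; split=> [//|A /G0F /Fp //|]; move: FpF; rewrite -pF'.
Qed.

End IdempotentUltrafilters.
#[local] Existing Instance fprod_filter.
#[local] Existing Instance fprod_proper.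

(** * Gowers ultrafilters *)

Lemma ultrafilterP (T : Type) (F : set_system T) : ProperFilter F ->
  (forall A, F A \/ F (~` A)) -> UltraFilter F.
Proof.
move=> pF dec; split=> // G pG FG; apply/seteqP; split=> // A GA.
have [//|/FG GnA] := dec A; exfalso; apply: (@filter_not_empty _ G _).
by rewrite -(setICr A); apply: filterI.
Qed.

Lemma fprod_ultra (T : Type) (op : T -> T -> T) (F G : set_system T) :
  UltraFilter F -> UltraFilter G -> UltraFilter (fprod op F G).
Proof.
move=> uF uG; apply: ultrafilterP => A.
have [|nA] := in_ultra_setVsetC [set x | G [set y | A (op x y)]] uF.
  by left.
right; apply: (@filterS _ F _ _ _ _ nA) => x /= nAx.
by have [|] := in_ultra_setVsetC [set y | A (op x y)] uG.
Qed.

Section Tetris.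

Lemma vjoinA : associative vjoin.
Proof. by move=> x y z; apply/funext => n; rewrite /vjoin maxnA. Qed.

Lemma vjoinC : commutative vjoin.
Proof. by move=> x y; apply/funext => n; rewrite /vjoin maxnC. Qed.

Lemma tetris0 x : tetris 0 x = x.
Proof. by apply/funext => n; rewrite /tetris subn0. Qed.

Lemma tetrisD i j x : tetris i (tetris j x) = tetris (i + j) x.
Proof. by apply/funext => n; rewrite /tetris -subnDA addnC. Qed.

Lemma tetris_join d x y : tetris d (vjoin x y) = vjoin (tetris d x) (tetris d y).
Proof. by apply/funext => n; rewrite /tetris /vjoin; lia. Qed.

Definition fin (j : nat) : set vec :=
  [set x | [/\ forall n, x n <= j, exists M, forall n, M <= n -> x n = 0
             & exists n, x n = j]].

Definition beyond (N : nat) : set vec := [set x | forall n, n < N -> x n = 0].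

Definition fshift (d : nat) (F : set_system vec) : set_system vec :=
  [set A | F [set x | A (tetris d x)]].

Lemma fin_join i j x y : i <= j -> fin i x -> fin j y -> fin j (vjoin x y).
Proof.
move=> ij [xi [M xM] _] [yj [M' yM'] [n yn]]; split.
- by move=> m; rewrite /vjoin geq_max yj (leq_trans (xi m) ij).
- by exists (maxn M M') => m; rewrite /vjoin => Hm; rewrite xM ?yM' //; lia.
- by exists n; rewrite /vjoin yn; have := xi n; lia.
Qed.

Lemma beyond_join N x y : beyond N x -> beyond N y -> beyond N (vjoin x y).
Proof. by move=> xN yN n nN; rewrite /vjoin xN ?yN. Qed.

Lemma lift_fin j N y : fin j y -> beyond N y ->
  exists x, [/\ fin j.+1 x, beyond N x & tetris 1 x = y].
Proof.
move=> [yj [M yM] [n yn]] yN.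
(* The value 1 placed at N vanishes under T; it provides the value j + 1 when j = 0, where y is the
   zero vector. *)
exists (fun m => if y m == 0 then (m == N : nat) else (y m).+1); split.
- split.
  + by move=> m; have := yj m; case: (y m == 0); case: (m == N).
  + exists (maxn M N.+1) => m Hm; rewrite yM ?eqxx; last by lia.
    by case: eqP => //; lia.
  + case: (posnP j) => [j0|j0].
      exists N; have := yj N; rewrite j0 leqn0 => ->; by rewrite eqxx.
    by exists n; rewrite yn -[j == 0]negbK -lt0n j0.
- move=> m mN; rewrite yN ?eqxx //; by case: eqP => //; lia.
- by apply/funext => m; rewrite /tetris; case: eqP => [->|_]; [case: eqP|lia].
Qed.

Local Notation "F ** G" := (fprod vjoin F G) (at level 40).

(** The join is total here. That U contains every [beyond N] lets generic vectors start after
    whatever has been chosen, which replaces a partial operation on vectors with ordered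
    supports. *)
Definition gowers (j : nat) (U : set_system vec) :=
  [/\ UltraFilter U, U (fin j), forall N, U (beyond N)
    & forall d, U ** fshift d U = U /\ fshift d U ** U = U].

Lemma gowers0 : gowers 0 (principal_filter (fun=> 0)).
Proof.
have pP A : principal_filter (fun=> 0) A = A (fun=> 0) :> Prop.
  by apply/propext; split=> [/principal_filterP|/principal_filterP].
split; first exact: principal_filter_ultra.
- by rewrite pP; split=> //; exists 0.
- by move=> N; rewrite pP.
- move=> d; split; apply/funext => A; rewrite /fprod /fshift /= !pP /= ?pP;
  congr A; apply/funext => n; by rewrite /vjoin /tetris.
Qed.

Lemma fshift_prod d (F G : set_system vec) :
  fshift d (F ** G) = fshift d F ** fshift d G.
Proof.
apply/funext => A; rewrite /fprod /fshift /=; congr (F _); apply/funext => x /=.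
by congr (G _); apply/funext => y /=; rewrite tetris_join.
Qed.

Lemma fshift0 F : fshift 0 F = F.
Proof.
by apply/funext => A; rewrite /fshift /=; congr (F _); apply/funext => x; rewrite /= tetris0.
Qed.

Lemma fshift_filter d (F : set_system vec) : Filter F -> Filter (fshift d F).
Proof.
move=> fF; split.
- exact: filterT.
- by move=> A B; apply: filterI.
- by move=> A B AB; apply: (@filterS _ F) => x; apply: AB.
Qed.

Lemma fshift_proper d (F : set_system vec) : ProperFilter F -> ProperFilter (fshift d F).
Proof.
by move=> pF; split; [exact: filter_not_empty|exact: fshift_filter].
Qed.

Definition lifts j (p : set_system vec) : set_system vec :=
  [set A | exists N B, p B /\
    forall x, fin j.+1 x -> beyond N x -> B (tetris 1 x) -> A x].

Lemma lifts_proper j p : gowers j p -> ProperFilter (lifts j p).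
Proof.
move=> [up pfin pbey _]; apply: Build_ProperFilter_ex.
  move=> A [N [B [pB BA]]].
  have [y [By [fy by_]]] := filter_ex (filterI pB (filterI pfin (pbey N))).
  have [x [fx bx Tx]] := lift_fin fy by_.
  by exists x; apply: BA; rewrite ?Tx.
split.
- by exists 0, setT; split=> //; exact: filterT.
- move=> A A' [N [B [pB BA]]] [N' [B' [pB' BA']]].
  exists (maxn N N'), (B `&` B'); split; first exact: filterI.
  move=> x fx bx [Bx B'x]; split; [apply: BA|apply: BA'] => //;
    by move=> n Hn; apply: bx; lia.
- by move=> A A' AA' [N [B [pB BA]]]; exists N, B; split=> // x *; apply/AA'/BA.
Qed.

Lemma lifts_subidem j p : gowers j p -> lifts j p `<=` lifts j p ** lifts j p.
Proof.
move=> [up pfin pbey pT] A [N [B [pB BA]]].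
have pp : p ** p = p by have := (pT 0).1; rewrite fshift0.
exists N, [set u | p [set v | B (vjoin u v)]]; split.
  by rewrite -pp in pB.
move=> x fx bx Bx; exists N, [set v | B (vjoin (tetris 1 x) v)]; split=> //.
move=> y fy by_ By; apply: BA; first exact: fin_join fx fy.
  exact: beyond_join.
by rewrite tetris_join.
Qed.

Lemma lifts_absorb j p : gowers j p -> lifts j p `<=` p ** lifts j p.
Proof.
move=> [up pfin pbey pT] A [N [B [pB BA]]].
have pB1 : p [set x | p [set y | B (vjoin (tetris 1 x) y)]].
  by rewrite -(pT 1).2 in pB.
apply: (@filterS _ p _ _ _ _ (filterI pB1 (filterI pfin (pbey N)))).
move=> x [Bx [fx bx]]; exists N, [set v | B (vjoin (tetris 1 x) v)]; split=> //.
move=> y fy by_ By; apply: BA; first exact: (fin_join _ fx fy).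
  exact: beyond_join.
by rewrite tetris_join.
Qed.

(* An idempotent q above F * p, where F is generated by the T-preimages of the    *)
(* sets in p, satisfies q * p = q, and then p * q is as required.                 *)
Lemma gowersS j p : gowers j p -> exists U, gowers j.+1 U.
Proof.
move=> tp; have [up pfin pbey pT] := tp.
have pp : p ** p = p by have := (pT 0).1; rewrite fshift0.
have pp' : ProperFilter p by exact _.
set F := lifts j p; have pF : ProperFilter F := lifts_proper tp.
have FF : F `<=` F ** F := lifts_subidem tp.
have pG : ProperFilter (F ** p) by exact: fprod_proper.
have sG : subidem vjoin (F ** p).
  rewrite /subidem; apply: (@subset_trans _ (F ** (F ** p))).
    by rewrite (fprodA vjoinA); exact: fprodS.
  rewrite -(fprodA vjoinA); apply: fprodS => //.
  by rewrite (fprodA vjoinA); apply: fprodS => //; exact: lifts_absorb.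
have [q [uq Gq qq]] := idempotent_ultrafilter vjoinA pG sG.
have pq : ProperFilter q by exact _.
(* By compactness q = X * p for a filter X, hence q * p = X * p * p = X * p = q. *)
have qp : q ** p = q.
  have pX : ProperFilter (fquot vjoin F p q) by exact: fquot_proper.
  have qE : fquot vjoin F p q ** p = q.
    by apply: max_filter; exact: sub_fprod_fquot.
  by rewrite -[in LHS]qE -(fprodA vjoinA) pp.
(* Applying T to [F ** p] gives a filter above p * T p = p, and p is maximal. *)
have Tq : fshift 1 q = p.
  have pTq : ProperFilter (fshift 1 q) := fshift_proper 1 pq.
  apply: max_filter.
  move=> B pB; apply: Gq; exists 0, [set u | p [set y | B (vjoin u (tetris 1 y))]].
  split; first by rewrite -(pT 1).1 in pB.
  by move=> x _ _; apply: (@filterS _ p) => y /=; rewrite tetris_join.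
have TU : fshift 1 (p ** q) = p by rewrite fshift_prod Tq (pT 1).2.
have TdU d : fshift d.+1 (p ** q) = fshift d p.
  rewrite -[in RHS]TU; apply/funext => A; rewrite /fshift /=.
  by congr (fprod vjoin p q _); apply/funext => x /=; rewrite tetrisD addn1.
(* q absorbs p on its right; the factor p in front supplies the absorption on the left. *)
exists (p ** q); split; first exact: fprod_ultra.
- apply: (@filterS _ p _ _ _ _ pfin) => x fx /=.
  have : q [set y | fin j.+1 y].
    apply: Gq; exists 0, setT; split; first exact: filterT.
    move=> y fy _ _ /=; apply: (@filterS _ p _ _ _ _ pfin) => z fz /=.
    by rewrite vjoinC; apply: fin_join fz fy.
  by apply: (@filterS _ q) => y fy /=; apply: fin_join fx fy.
- move=> N; apply: (@filterS _ p _ _ _ _ (pbey N)) => x bx /=.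
  have : q (beyond N).
    apply: Gq; exists N, setT; split; first exact: filterT.
    move=> y _ by_ _ /=; apply: (@filterS _ p _ _ _ _ (pbey N)) => z bz /=.
    exact: beyond_join.
  by apply: (@filterS _ q) => y bY /=; apply: beyond_join.
- have qpT d : q ** fshift d p = q ** p ** fshift d p by rewrite qp.
  case=> [|d]; rewrite ?fshift0 ?TdU; split.
  + by rewrite -[in LHS](fprodA vjoinA) (fprodA vjoinA q) qp qq.
  + by rewrite -[in LHS](fprodA vjoinA) (fprodA vjoinA q) qp qq.
  + by rewrite -(fprodA vjoinA) qpT -(fprodA vjoinA q) (pT d).1 qp.
  + by rewrite (fprodA vjoinA) (pT d).2.
Qed.

Lemma gowers_exists j : exists U, gowers j U.
Proof.
elim: j => [|j [p]]; first by eexists; exact: gowers0.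
exact: gowersS.
Qed.

End Tetris.

(** * Generic insertions and thresholds *)

Section Calculus.
Variables (k : nat) (U : set_system vec).
Hypothesis tU : gowers k U.

Local Notation "x |v| y" := (vjoin x y) (at level 50, left associativity).

#[local] Instance gowers_ultra : UltraFilter U.
Proof. by case: tU. Qed.

(* Scales a vector of FIN_k to maximum c, by T^(k - c). *)
Definition lv (c : nat) (x : vec) : vec := tetris (k - c) x.

Lemma gowers_after d (P : vec -> Prop) :
  U (fun x => U (fun y => P (x |v| tetris d y))) = U P.
Proof. by case: tU => _ _ _ /(_ d) [e _]; rewrite -[in RHS]e. Qed.

Lemma gowers_before d (P : vec -> Prop) :
  U (fun y => U (fun x => P (tetris d y |v| x))) = U P.
Proof. by case: tU => _ _ _ /(_ d) [_ e]; rewrite -[in RHS]e. Qed.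

Lemma gowers_bounded : U (fun x => forall n, x n <= k).
Proof. by case: tU => _ fU _ _; apply: (@filterS _ U _ _ _ _ fU) => x []. Qed.

Lemma lv_join c x y : lv c (x |v| y) = lv c x |v| lv c y.
Proof. exact: tetris_join. Qed.

Lemma lv_tetris c d x : c <= k -> (forall n, x n <= k) ->
  lv c (tetris d x) = lv (c - d) x.
Proof.
move=> ck xk; apply/funext => n; rewrite /lv /tetris; have := xk n.
by have [dc|cd] := leqP d c; lia.
Qed.

Lemma lv0 x : (forall n, x n <= k) -> lv 0 x = fun=> 0.
Proof. by move=> xk; apply/funext => n; rewrite /lv /tetris; have := xk n; lia. Qed.

(** Both sides receive the same generic vector, at levels p and q: these are letters in the same
    place of two words. *)
Definition step (p q : nat) (rho : vec -> vec -> Prop) (u v : vec) : Prop :=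
  U (fun x => rho (u |v| lv p x) (v |v| lv q x)).

Definition pat (pi : seq (nat * nat)) (rho : vec -> vec -> Prop) :=
  foldr (fun pq => step pq.1 pq.2) rho pi.

Lemma eq_U (P Q : vec -> Prop) : U (fun x => P x <-> Q x) -> U P = U Q.
Proof.
move=> PQ; apply/propext; split.
  by move: PQ; apply: filterS2 => x [].
by move: PQ; apply: filterS2 => x [].
Qed.

(** The shift by d acts on both sides at once, so a pair absorbs a smaller neighbour with the same
    difference p - q. Below 0 the truncated subtraction agrees with T, by [lv_tetris]. *)
Lemma step_after p q d rho u v : p <= k -> q <= k ->
  step p q (step (p - d) (q - d) rho) u v = step p q rho u v.
Proof.
move=> pk qk; rewrite [RHS]/step -(gowers_after d); apply: eq_U.
apply: filterE => x; rewrite /step; set A := U _; set B := U _.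
suff -> : A = B by [].
apply: eq_U; apply: (@filterS _ U _ _ _ _ gowers_bounded) => y yk.
by rewrite !lv_join !lv_tetris // !vjoinA.
Qed.

Lemma step_before p q d rho u v : p <= k -> q <= k ->
  step (p - d) (q - d) (step p q rho) u v = step p q rho u v.
Proof.
move=> pk qk; rewrite [RHS]/step -(gowers_before d); apply: eq_U.
apply: (@filterS _ U _ _ _ _ gowers_bounded) => y yk; rewrite /step.
set A := U _; set B := U _; suff -> : A = B by [].
apply: eq_U; apply: filterE => x.
by rewrite !lv_join !lv_tetris // !vjoinA.
Qed.

Lemma step_max c d rho u v : c <= k -> d <= k ->
  step c c (step d d rho) u v = step (maxn c d) (maxn c d) rho u v.
Proof.
move=> ck dk; have [cd|/ltnW dc] := leqP c d.
  by rewrite -{1 2}(subKn cd) step_before.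
by rewrite -{1 2}(subKn dc) step_after.
Qed.

Lemma step_merge p q p' q' rho u v : p <= k -> q <= k -> p' <= k -> q' <= k ->
  p + q' = q + p' ->
  step p q (step p' q' rho) u v =
  if p' <= p then step p q rho u v else step p' q' rho u v.
Proof.
move=> pk qk pk' qk' e; case: leqP => [pp|/ltnW pp].
  have -> : p' = p - (p - p') by lia.
  have -> : q' = q - (p - p') by lia.
  exact: step_after.
have -> : p = p' - (p' - p) by lia.
have -> : q = q' - (p' - p) by lia.
exact: step_before.
Qed.

Lemma vjoin0 (x : vec) : x |v| (fun=> 0) = x.
Proof. by apply/funext => n; rewrite /vjoin maxn0. Qed.

Lemma step0 rho u v : step 0 0 rho u v = rho u v.
Proof.
rewrite /step; apply/propext; split.
  move=> H; have [x [xk]] := filter_ex (filterI gowers_bounded H).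
  by rewrite !lv0 // !vjoin0.
move=> H; apply: (@filterS _ U _ _ _ _ gowers_bounded) => x xk.
by rewrite !lv0 // !vjoin0.
Qed.

(** Absorption read backwards: a generic letter may be replaced by itself followed by another one
    that is not larger. *)
Lemma split_after c d (P : vec -> Prop) : d <= c -> c <= k ->
  U (fun x => P (lv c x)) = U (fun x => U (fun y => P (lv c x |v| lv d y))).
Proof.
move=> dc ck; rewrite -[LHS](gowers_after (c - d)); congr (U _).
apply/funext => x; congr (U _); apply/funext => y.
rewrite lv_join /lv tetrisD; congr (P (_ |v| tetris _ _)); lia.
Qed.

Lemma split_before c d (P : vec -> Prop) : d <= c -> c <= k ->
  U (fun x => P (lv c x)) = U (fun y => U (fun x => P (lv d y |v| lv c x))).
Proof.
move=> dc ck; rewrite -[LHS](gowers_before (c - d)); congr (U _).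
apply/funext => x; congr (U _); apply/funext => y.
rewrite lv_join /lv tetrisD; congr (P (tetris _ _ |v| _)); lia.
Qed.

Section Threshold.
Variable R : vec -> vec -> Prop.
Hypothesis Rrefl : forall u, R u u.
Hypothesis Rsym : forall u v, R u v -> R v u.
Hypothesis Rtrans : forall u v w, R u v -> R v w -> R u w.

Definition negligible (a b e : nat) : Prop :=
  U (fun x => U (fun y => U (fun z =>
    R (lv a x |v| lv e y |v| lv b z) (lv a x |v| lv b z)))).

Lemma negligible0 a b : negligible a b 0.
Proof.
apply: filterE => x; apply: (@filterS _ U _ _ _ _ gowers_bounded) => y yk.
by apply: filterE => z; rewrite lv0 // vjoin0.
Qed.

(** If e' <= a, then a e' counts as a letter a and e' e as a letter e. In a e' e b, deleting e
    leaves a e' b and deleting e' e leaves a b, so these two are related. Otherwise e' <= b because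
    [maxn a b = k], and the mirror image applies. *)
Lemma negligible_down a b e e' : a <= k -> b <= k -> maxn a b = k ->
  e' <= e -> e <= k -> negligible a b e -> negligible a b e'.
Proof.
move=> ak bk ab le ek H.
have [ea|ae] := leqP e' a.
  have H1 : U (fun x => U (fun x' => U (fun y => U (fun z =>
      R (lv a x |v| lv e' x' |v| lv e y |v| lv b z)
        (lv a x |v| lv e' x' |v| lv b z))))).
    by move: H; rewrite /negligible (split_after (fun X => U (fun y => U (fun z =>
      R (X |v| lv e y |v| lv b z) (X |v| lv b z)))) ea ak).
  move: H H1; apply: filterS2 => x.
  rewrite (split_before (fun Y => U (fun z =>
      R (lv a x |v| Y |v| lv b z) (lv a x |v| lv b z))) le ek).
  (* [filter_const] introduces the generic vector that serves only as a link between the two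
     sides. *)
  apply: filterS2 => y' H1 H2; apply: (@filter_const _ U _).
  move: H1 H2; apply: filterS2 => y; apply: filterS2 => z.
  by rewrite !vjoinA => H1 /Rsym H2; apply: Rtrans H2 H1.
have eb : e' <= b by move: ab ae le ek; lia.
move: H; apply: filterS => x H.
have H1 : U (fun y => U (fun z' => U (fun z =>
    R (lv a x |v| lv e y |v| lv e' z' |v| lv b z)
      (lv a x |v| lv e' z' |v| lv b z)))).
  move: H; apply: filterS => y.
  rewrite (split_before (fun Z =>
    R (lv a x |v| lv e y |v| Z) (lv a x |v| Z)) eb bk).
  by apply: filterS => z'; apply: filterS => z; rewrite !vjoinA.
apply: (@filter_const _ U _).
move: H H1; rewrite (split_after (fun Y => U (fun z =>
      R (lv a x |v| Y |v| lv b z) (lv a x |v| lv b z))) le ek).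
apply: filterS2 => y; apply: filterS2 => y'; apply: filterS2 => z.
by rewrite !vjoinA => H1 /Rsym H2; apply: Rtrans H2 H1.
Qed.

Lemma negligible_persist_left a a' e : a <= a' -> a' <= k -> e <= k ->
  negligible a k a' -> negligible a' k e <-> negligible a k e.
Proof.
move=> aa ak ek H.
pose Q := U (fun x => U (fun y => U (fun w => U (fun z =>
  R (lv a x |v| lv a' y |v| lv e w |v| lv k z) (lv a x |v| lv a' y |v| lv k z))))).
have -> : negligible a' k e = Q.
  by rewrite /negligible (split_before (fun X => U (fun y => U (fun z =>
      R (X |v| lv e y |v| lv k z) (X |v| lv k z)))) aa ak).
have H1 : U (fun x => U (fun y => U (fun w => U (fun z =>
  R (lv a x |v| lv a' y |v| lv e w |v| lv k z) (lv a x |v| lv e w |v| lv k z))))).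
  move: H; apply: filterS => x; apply: filterS => y.
  rewrite (split_before (fun Z => R (lv a x |v| lv a' y |v| Z) (lv a x |v| Z)) ek) //.
  by apply: filterS => w; apply: filterS => z; rewrite !vjoinA.
split=> HQ.
  move: HQ H H1; apply: filterS3 => x HQ H H1; apply: (@filter_const _ U _).
  move: HQ H H1; apply: filterS3 => y HQ H H1.
  move: HQ H1; apply: filterS2 => w HQ H1; move: HQ H H1; apply: filterS3 => z.
  by move=> h1 h2 /Rsym h3; apply: Rtrans h3 (Rtrans h1 h2).
move: HQ H H1; apply: filterS3 => x HQ.
apply: filterS2 => y H H1; move: HQ H1; apply: filterS2 => w HQ H1.
move: HQ H H1; apply: filterS3 => z.
by move=> h1 /Rsym h2 h3; apply: Rtrans h3 (Rtrans h1 h2).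
Qed.

Lemma negligible_persist_right b b' e : b <= b' -> b' <= k -> e <= k ->
  negligible k b b' -> negligible k b' e <-> negligible k b e.
Proof.
move=> bb bk ek H.
pose Q := U (fun x => U (fun w => U (fun y => U (fun z =>
  R (lv k x |v| lv e w |v| lv b' y |v| lv b z) (lv k x |v| lv b' y |v| lv b z))))).
have -> : negligible k b' e = Q.
  rewrite /negligible; congr (U _); apply/funext => x; congr (U _).
  apply/funext => w.
  rewrite (split_after (fun Z => R (lv k x |v| lv e w |v| Z) (lv k x |v| Z)) bb bk).
  by congr (U _); apply/funext => y; congr (U _); apply/funext => z; rewrite !vjoinA.
have H1 : U (fun x => U (fun w => U (fun y => U (fun z =>
  R (lv k x |v| lv e w |v| lv b' y |v| lv b z) (lv k x |v| lv e w |v| lv b z))))).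
  move: H; rewrite /negligible (split_after (fun X => U (fun y => U (fun z =>
      R (X |v| lv b' y |v| lv b z) (X |v| lv b z)))) ek) //.
split=> HQ.
  move: HQ H H1; apply: filterS3 => x HQ H H1.
  move: HQ H1; apply: filterS2 => w HQ H1; apply: (@filter_const _ U _).
  move: HQ H H1; apply: filterS3 => y; apply: filterS3 => z.
  by move=> h1 h2 /Rsym h3; apply: Rtrans h3 (Rtrans h1 h2).
move: HQ H H1; apply: filterS3 => x HQ H H1.
move: HQ H1; apply: filterS2 => w HQ H1; move: H H1; apply: filterS2 => y H H1.
move: HQ H H1; apply: filterS3 => z.
by move=> h1 /Rsym h2 h3; apply: Rtrans h3 (Rtrans h1 h2).
Qed.

(* The least letter which is not negligible; it is k + 1 if there is none. *)
Definition thr (a b : nat) : nat :=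
  find (fun e => ~~ `[< negligible a b e >]) (iota 0 k.+1).

Lemma thrP a b e : a <= k -> b <= k -> maxn a b = k -> e <= k ->
  e < thr a b <-> negligible a b e.
Proof.
move=> ak bk ab ek; split.
  move=> /(before_find 0); rewrite nth_iota // add0n => /negbFE /asboolP; exact.
move=> H; rewrite ltnNge; apply/negP => le.
have lt : thr a b < k.+1 by apply: leq_ltn_trans le _.
have hs : has (fun e => ~~ `[< negligible a b e >]) (iota 0 k.+1).
  by rewrite has_find size_iota.
have := nth_find 0 hs; rewrite -/(thr a b) nth_iota // add0n => /asboolP; apply.
exact: negligible_down H.
Qed.

Lemma thr_gt0 a b : a <= k -> b <= k -> maxn a b = k -> 0 < thr a b.
Proof. by move=> ak bk ab; apply/thrP => //; exact: negligible0. Qed.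

Lemma thr_le a b : thr a b <= k.+1.
Proof. by rewrite -[X in _ <= X](size_iota 0) find_size. Qed.

Lemma eq_thr a b a' b' : (forall e, e <= k -> negligible a b e <-> negligible a' b' e) ->
  thr a b = thr a' b'.
Proof.
move=> H; apply: eq_in_find => e; rewrite mem_iota ltnS /= => ek.
by congr (~~ _); apply: asbool_equiv_eq; exact: H.
Qed.

Lemma thr_persist_left a a' : a <= a' -> a' <= k -> a' < thr a k -> thr a' k = thr a k.
Proof.
move=> aa ak /thrP h; apply: eq_thr => e ek; apply: negligible_persist_left => //.
by apply: h => //; lia.
Qed.

Lemma thr_persist_right b b' : b <= b' -> b' <= k -> b' < thr k b -> thr k b' = thr k b.
Proof.
move=> bb bk /thrP h; apply: eq_thr => e ek; apply: negligible_persist_right => //.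
by apply: h => //; lia.
Qed.

(** Gives [negligible] the form of a pattern over the empty word, to which statements on longer
    words are pulled back. *)
Lemma negligibleE a b e :
  step a a (step e 0 (step b b R)) (fun=> 0) (fun=> 0) = negligible a b e.
Proof.
have v0 x : (fun=> 0) |v| x = x by rewrite vjoinC vjoin0.
apply: eq_U; apply: filterE => x; rewrite v0.
set A := step _ _ _ _ _; set B := U _; suff -> : A = B by [].
apply: eq_U; apply: (@filterS _ U _ _ _ _ gowers_bounded) => y yk.
by rewrite (lv0 yk) vjoin0.
Qed.

Lemma step_refl b u : step b b R u u.
Proof. exact: filterE. Qed.

Lemma step_sym b u v : step b b R u v -> step b b R v u.
Proof. by apply: filterS => x; apply: Rsym. Qed.

Lemma step_trans b u v w : step b b R u v -> step b b R v w -> step b b R u w.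
Proof. by apply: filterS2 => x; apply: Rtrans. Qed.

End Threshold.

Section PartialBijections.
Variable D : vec -> vec -> Prop.
Hypothesis Dsym : forall u v, D u v -> D v u.
Hypothesis Dtrans : forall u v w, D u v -> D v w -> D u w.

(* rho induces a bijection between sets of D-classes. *)
Definition bijmod (rho : vec -> vec -> Prop) : Prop :=
  [/\ forall u u' v v', rho u v -> D u u' -> D v v' -> rho u' v',
      forall u u' v, rho u v -> rho u' v -> D u u'
    & forall u v v', rho u v -> rho u v' -> D v v'].

Lemma bijmod_refl : bijmod D.
Proof.
split=> [u u' v v' uv uu vv|u u' v uv u'v|u v v' uv uv'].
- exact: Dtrans (Dtrans (Dsym uu) uv) vv.
- exact: Dtrans uv (Dsym u'v).
- exact: Dtrans (Dsym uv) uv'.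
Qed.

Lemma bijmod_step p q rho : p <= k -> q <= k ->
  (forall c u v, c <= k -> step c c D u v = D u v) ->
  bijmod rho -> bijmod (step p q rho).
Proof.
move=> pk qk Dc [r1 r2 r3]; split=> [u u' v v' uv|u u' v uv u'v|u v v' uv uv'].
- rewrite -(Dc p) // -(Dc q v) // => uu vv; move: uv uu vv.
  by apply: filterS3 => x; apply: r1.
- by rewrite -(Dc p) //; move: uv u'v; apply: filterS2 => x; apply: r2.
- by rewrite -(Dc q) //; move: uv uv'; apply: filterS2 => x; apply: r3.
Qed.

(** Transfer of erasability: if the letter e does not change the class of u, then v followed by f is
    related to u just as v is, and injectivity modulo D puts both into one class. *)
Lemma bijmod_insert e f rho u v : bijmod rho -> (forall u, D u u) ->
  rho u v -> step e f rho u v -> step e 0 D u u <-> step f 0 D v v.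
Proof.
move=> [r1 r2 r3] Drefl uv uev.
have s0 g w : step g 0 D w w = U (fun x => D (w |v| lv g x) w).
  apply: eq_U; apply: (@filterS _ U _ _ _ _ gowers_bounded) => y yk.
  by rewrite (lv0 yk) vjoin0.
rewrite !s0; split=> H; move: H uev; apply: filterS2 => x.
  by move=> h1 h2; apply: r3 (r1 _ _ _ _ h2 h1 (Drefl _)) uv.
by move=> h1 h2; apply: r2 (r1 _ _ _ _ h2 (Drefl _) h1) uv.
Qed.

End PartialBijections.
End Calculus.

(** * Generic block sequences by fusion *)

Lemma filter_forall (T : Type) (I : finType) (F : set_system T) (P : I -> T -> Prop) :
  Filter F -> (forall i, F (P i)) -> F (fun x => forall i, P i x).
Proof.
move=> fF FP; have : F (fun x => forall i, i \in enum I -> P i x).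
  elim: (enum I) => [|j s IH]; first exact: filterE.
  move: (FP j) IH; apply: filterS2 => x Pj Ps i; rewrite inE => /orP[/eqP -> //|].
  exact: Ps.
by apply: filterS => x Px i; apply: Px; rewrite mem_enum.
Qed.

Lemma ultra_self (T : Type) (F : set_system T) (P : T -> Prop) :
  UltraFilter F -> F (fun x => F P <-> P x).
Proof.
move=> uF; have [FP|FnP] := in_ultra_setVsetC P uF.
  by apply: (@filterS _ F _ _ _ _ FP).
apply: (@filterS _ F _ _ _ _ FnP) => x nPx; split=> // FP.
by have [y []] := filter_ex (filterI FP FnP).
Qed.

Lemma history_choice (T : Type) (Phi : seq T -> T -> Prop) :
  (forall s, exists x, Phi s x) -> exists b, forall n, Phi (mkseq b n) (b n).
Proof.
move=> /choice [g gP]; pose h n := iter n (fun s => rcons s (g s)) [::].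
exists (fun n => g (h n)) => n.
suff -> : mkseq (fun n => g (h n)) n = h n by [].
by elim: n => // n IH; rewrite mkseqS IH.
Qed.

Section Generic.
Variables (k : nat) (U : set_system vec).
Hypothesis tU : gowers k U.

Local Notation "x |v| y" := (vjoin x y) (at level 50, left associativity).
Local Notation lv := (lv k).
Local Notation step := (step k U).
Local Notation pat := (pat k U).
#[local] Instance generic_ultra : UltraFilter U := gowers_ultra tU.

Fixpoint val (b : nat -> vec) (w : nat -> nat) (n : nat) : vec :=
  if n is m.+1 then val b w m |v| lv (w m) (b m) else fun=> 0.

Lemma eq_val b b' w w' n : (forall j, j < n -> b j = b' j) ->
  (forall j, j < n -> w j = w' j) -> val b w n = val b' w' n.
Proof.
elim: n => //= n IH bb ww; rewrite bb ?ww // IH // => j jn;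
  by rewrite ?bb ?ww //; lia.
Qed.

Definition word (w : nat -> nat) := forall j, w j <= k.

Definition pattern (K : nat) (pi : seq (nat * nat)) :=
  size pi <= K /\ all (fun pq => (pq.1 <= k) && (pq.2 <= k)) pi.

(* The blocks b n of a generic sequence decide relations like generic vectors do,  *)
(* for patterns of bounded length only.                                            *)
Definition generic (I : finType) (rho : I -> vec -> vec -> Prop) (K : nat)
    (b : nat -> vec) : Prop :=
  [/\ forall n, fin k (b n),
      forall i j, i < j -> forall m m', b i m <> 0 -> b j m' <> 0 -> m < m'
    & forall n c pi w w', word w -> word w' -> pattern K pi ->
        pat ((w n, w' n) :: pi) (rho c) (val b w n) (val b w' n) <->
        pat pi (rho c) (val b w n.+1) (val b w' n.+1)].

Definition ord_pat (pi : seq ('I_k.+1 * 'I_k.+1)) : seq (nat * nat) :=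
  [seq (nat_of_ord pq.1, nat_of_ord pq.2) | pq <- pi].

Lemma patternP K pi : pattern K pi ->
  exists pi' : K.-bseq ('I_k.+1 * 'I_k.+1), pi = ord_pat pi'.
Proof.
move=> [sz al]; pose pi' : seq ('I_k.+1 * 'I_k.+1) :=
  [seq (inord pq.1, inord pq.2) | pq <- pi].
have sz' : size pi' <= K by rewrite size_map.
exists (Bseq sz'); rewrite /= /ord_pat /pi' -map_comp map_id_in // => -[p q] pq.
by have /andP[/= pk qk] := allP al _ pq; rewrite /= !inordK.
Qed.

Definition ffword n (f : {ffun 'I_n -> 'I_k.+1}) (j : nat) : nat :=
  if insub j is Some i then f i else 0.

Lemma ffwordP n w : word w ->
  exists f : {ffun 'I_n -> 'I_k.+1}, forall j, j < n -> w j = ffword f j.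
Proof.
move=> wk; exists [ffun i : 'I_n => inord (w i)] => j jn.
by rewrite /ffword insubT ffunE /= inordK // ltnS.
Qed.

Lemma generic_exists (I : finType) (rho : I -> vec -> vec -> Prop) K :
  exists b, generic rho K b.
Proof.
pose after (y x : vec) := forall m m', y m <> 0 -> x m' <> 0 -> m < m'.
(* For a given s these are finitely many conditions on x: levels are ordinals, patterns have length
   at most K, words are cut to the length of s. The premise on N is there because s ranges over
   arbitrary lists, whose entries may have infinite support. *)
pose Phi (s : seq vec) (x : vec) := [/\ fin k x,
  forall i : 'I_(size s), (exists N, forall n, N <= n -> nth (fun=> 0) s i n = 0) ->
      after (nth (fun=> 0) s i) x
  & forall (c : I) (pi : K.-bseq ('I_k.+1 * 'I_k.+1)) (p q : 'I_k.+1)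
      (f g : {ffun 'I_(size s) -> 'I_k.+1}),
    let u := val (nth (fun=> 0) s) (ffword f) (size s) in
    let v := val (nth (fun=> 0) s) (ffword g) (size s) in
    step p q (pat (ord_pat pi) (rho c)) u v <->
    pat (ord_pat pi) (rho c) (u |v| lv p x) (v |v| lv q x)].
have [_ fU bU _] := tU.
have [|b bP] := @history_choice _ Phi.
  move=> s; suff : U (Phi s) by apply: filter_ex.
  suff : U (fun x => forall i : 'I_(size s),
      (exists N, forall n, N <= n -> nth (fun=> 0) s i n = 0) ->
      after (nth (fun=> 0) s i) x) /\
    U (fun x => forall (c : I) (pi : K.-bseq ('I_k.+1 * 'I_k.+1)) (p q : 'I_k.+1)
      (f g : {ffun 'I_(size s) -> 'I_k.+1}),
    let u := val (nth (fun=> 0) s) (ffword f) (size s) in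
    let v := val (nth (fun=> 0) s) (ffword g) (size s) in
    step p q (pat (ord_pat pi) (rho c)) u v <->
    pat (ord_pat pi) (rho c) (u |v| lv p x) (v |v| lv q x)).
    by move=> [h1 h2]; move: fU h1 h2; apply: filterS3.
  split.
    apply: filter_forall => i.
    have [[N hN]|nN] := pselect (exists N, forall n, N <= n -> nth (fun=> 0) s i n = 0).
      apply: (@filterS _ U _ _ _ _ (bU N)) => x bx _ m m' ym xm'.
      rewrite ltnNge; apply/negP => m'm; have [Nm|mN] := leqP N m.
        by apply: ym; apply: hN.
      by apply: xm'; apply: bx; lia.
    exact: filterE.
  by do 6 apply: filter_forall => ?; exact: ultra_self.
exists b; split=> [n|i j ij|n c pi w w' wk wk' piK].
- by have [] := bP n.
- have [_ + _] := bP j; have szj : i < size (mkseq b j) by rewrite size_mkseq.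
  move=> /(_ (Ordinal szj)); rewrite /after /= nth_mkseq // => h m m'.
  by apply: h; have [[_ [N hN] _] _ _] := bP i; exists N.
- have [_ _ h] := bP n; have [pi' ->] := patternP piK.
  move: h; rewrite size_mkseq => /(_ c pi' (inord (w n)) (inord (w' n))).
  have [f fw] := ffwordP n wk; have [g gw] := ffwordP n wk' => /(_ f g) /=.
  have bb j : j < n -> nth (fun=> 0) (mkseq b n) j = b j by move=> ?; rewrite nth_mkseq.
  rewrite -(eq_val (fun j jn => esym (bb j jn)) fw).
  rewrite -(eq_val (fun j jn => esym (bb j jn)) gw).
  by rewrite !inordK ?ltnS.
Qed.

End Generic.

(** * Words over a generic sequence *)

Section GenericWords.
Variables (k : nat) (U : set_system vec).
Hypothesis tU : gowers k U.
Variables R S : vec -> vec -> Prop.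
Hypothesis Rrefl : forall u, R u u.
Hypothesis Rsym : forall u v, R u v -> R v u.
Hypothesis Rtrans : forall u v w, R u v -> R v w -> R u w.
Variable b : nat -> vec.
Hypothesis gb : generic k U (fun c : bool => if c then R else S) k.+4 b.

Local Notation "x |v| y" := (vjoin x y) (at level 50, left associativity).
Local Notation lv := (lv k).
Local Notation step := (step k U).
Local Notation pat := (pat k U).
Local Notation val := (val k b).
Local Notation word := (word k).
Local Notation pattern := (pattern k).
Local Notation thr := (thr k U R).
Local Notation negligible := (negligible k U R).
Local Notation D c := (step c c R).
#[local] Instance words_ultra : UltraFilter U := gowers_ultra tU.

Definition lev (w : nat -> nat) (m n : nat) : nat := \max_(m <= i < n) w i.

Lemma lev_nil w m : lev w m m = 0.
Proof. by rewrite /lev big_geq. Qed.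

Lemma levS w m n : m <= n -> lev w m n.+1 = maxn (lev w m n) (w n).
Proof. by move=> mn; rewrite /lev big_nat_recr. Qed.

Lemma lev_le w m n : word w -> lev w m n <= k.
Proof. by move=> wk; apply/bigmax_leqP_seq => i _ _; apply: wk. Qed.

Lemma eq_lev w w' m n : (forall j, m <= j < n -> w j = w' j) -> lev w m n = lev w' m n.
Proof. by move=> ww; apply: eq_big_nat. Qed.

Definition base (c : bool) := if c then R else S.

(** The blocks are pulled back into the pattern from right to left, where equal letters on both
    sides collapse to their maximum by [step_max]. *)
Lemma pat_common c a m d w w' pi : word w -> word w' ->
  pattern k.+4 ((a, a) :: pi) -> (forall j, m <= j < m + d -> w j = w' j) ->
  pat ((a, a) :: pi) (base c) (val w (m + d)) (val w' (m + d)) <->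
  pat ((maxn a (lev w m (m + d)), maxn a (lev w m (m + d))) :: pi) (base c)
    (val w m) (val w' m).
Proof.
move=> wk wk'; elim: d a => [|d IH] a pia ww.
  by rewrite addn0 lev_nil maxn0.
have [_ _ /(_ (m + d) c _ w w' wk wk' pia)] := gb; rewrite -addnS => <-.
rewrite addnS levS ?leq_addr // (maxnC (lev _ _ _)) maxnA.
have -> : w' (m + d) = w (m + d) by rewrite ww //; lia.
have [/= sz /andP[/andP[ak _] al]] := pia.
rewrite [X in X <-> _]/= step_max //.
rewrite (maxnC (w _)); apply: IH; last by move=> j hj; apply: ww; lia.
by split=> //=; rewrite geq_max ak wk.
Qed.

Lemma rel_common m n w w' : word w -> word w' -> m <= n ->
  (forall j, m <= j < n -> w j = w' j) ->
  R (val w n) (val w' n) <-> D (lev w m n) (val w m) (val w' m).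
Proof.
move=> wk wk' mn ww; have := @pat_common true 0 m (n - m) w w' [::] wk wk'.
by rewrite subnKC // max0n /= step0 //; apply.
Qed.

(** Compared with itself, the word is pulled back to the empty word, and only its maximum
    survives. *)
Lemma erase_level n w c e : word w -> c <= k -> e <= k ->
  step e 0 (D c) (val w n) (val w n) <-> negligible (lev w 0 n) c e.
Proof.
move=> wk ck ek.
have := @pat_common true 0 0 n w w [:: (e, 0); (c, c)] wk wk.
rewrite add0n max0n /= step0 // negligibleE //; apply=> //.
by split; rewrite //= ek ck.
Qed.

Lemma erase_thr n w e : word w -> e <= k ->
  step e 0 (D k) (val w n) (val w n) <-> e < thr (lev w 0 n) k.
Proof.
move=> wk ek; have lk := lev_le 0 n wk; rewrite erase_level //.
by rewrite thrP //; apply/maxn_idPr.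
Qed.

(** Reducedness in a context where a letter k follows, so that only the level to the left varies. *)
Definition left_reduced w n :=
  forall j, j < n -> w j <> 0 -> thr (lev w 0 j) k <= w j.

Lemma Drefl c u : D c u u.
Proof. exact: (step_refl tU Rrefl). Qed.

Lemma Dsym c u v : D c u v -> D c v u.
Proof. exact: (step_sym tU Rsym). Qed.

Lemma Dtrans c u v w : D c u v -> D c v w -> D c u w.
Proof. exact: (step_trans tU Rtrans). Qed.

Lemma Dabsorb c u v : c <= k -> step c c (D k) u v = D k u v.
Proof. by move=> ck; rewrite step_max // (maxn_idPr ck). Qed.

(* Invariant of a scan from right to left: the letters after position m can be     *)
(* compressed to a pattern of bounded length, because by absorption only pairs of  *)
(* letters with a new value of p - q, which are strict records, have to be kept.    *)
Definition chain w w' m := exists p q pi, 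
  [/\ [/\ pattern k.+1 ((p, q) :: pi), size ((p, q) :: pi) + lev w 0 m <= k.+1,
    bijmod (D k) (pat ((p, q) :: pi) R) &
    pat ((p, q) :: pi) R (val w m) (val w' m)],
    thr (lev w' 0 m) k + p = thr (lev w 0 m) k + q, lev w 0 m <= p & lev w' 0 m <= q].

Lemma chain_start w w' n : word w -> word w' -> D k (val w n) (val w' n) ->
  chain w w' n.
Proof.
move=> wk wk' Dn; exists k, k, [::]; have lk := lev_le 0 n wk; have lk' := lev_le 0 n wk'.
have bD : bijmod (D k) (D k).
  exact: bijmod_refl (@Dsym k) (@Dtrans k).
split=> //; first by split=> //=; split=> //=; rewrite leqnn.
congr (_ + _); have H e : e <= k -> e < thr (lev w 0 n) k <-> e < thr (lev w' 0 n) k.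
  move=> ek; rewrite -!erase_thr //.
  apply: (bijmod_insert tU bD (@Drefl k) Dn).
  by rewrite Dabsorb.
have := thr_le k U R (lev w 0 n) k; have := thr_le k U R (lev w' 0 n) k.
set A := thr (lev w 0 n) k in H *; set B := thr _ _ in H *.
by move: (H A) (H B); case: (ltngtP A B); lia.
Qed.

(** As d grows, p - d and q - d fall below their thresholds at the same moment, d = p - lam + 1.
    Truncation does no harm since both thresholds are positive. *)
Lemma gap_eq (lam lam' p q : nat) : 0 < lam' -> lam <= p ->
  (forall d, p - d < lam <-> q - d < lam') -> 0 < lam -> lam' + p = lam + q.
Proof.
move=> l0' lp H l0; have h1 := H (p - lam); have h2 := H (p - lam).+1.
by lia.
Qed.

(** The pair (p - d, q - d) inserted in front of (p, q) is absorbed, so the relation survives the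
    insertion and erasability transfers. *)
Lemma insert_before p q d pi w w' m : word w -> word w' -> p <= k -> q <= k ->
  bijmod (D k) (pat ((p, q) :: pi) R) ->
  pat ((p, q) :: pi) R (val w m) (val w' m) ->
  p - d < thr (lev w 0 m) k <-> q - d < thr (lev w' 0 m) k.
Proof.
move=> wk wk' pk qk bp h.
rewrite -!erase_thr //; try lia.
apply: (bijmod_insert tU bp (@Drefl k) h).
by rewrite /= step_before.
Qed.

Lemma insert_after p q d pi w w' m : word w -> word w' -> p <= k -> q <= k ->
  pattern k.+1 pi ->
  bijmod (D k) (pat pi R) -> w m = p -> w' m = q ->
  pat ((p, q) :: pi) R (val w m) (val w' m) ->
  p - d < thr (lev w 0 m.+1) k <-> q - d < thr (lev w' 0 m.+1) k.
Proof.
move=> wk wk' pk qk [sz al] bp wp wq h; have [_ _ G] := gb.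
rewrite -!erase_thr //; try lia.
apply: (bijmod_insert tU bp (@Drefl k)).
  by apply/(G m true pi w w' wk wk'); [split=> //; lia|rewrite wp wq].
apply/(G m true ((p - d, q - d) :: pi) w w' wk wk').
  by split=> /=; [lia|rewrite al andbT; lia].
by rewrite wp wq /= step_after.
Qed.

Lemma chain_step w w' n m : word w -> word w' ->
  left_reduced w n -> left_reduced w' n -> m < n -> chain w w' m.+1 ->
  chain w w' m /\ (w m = 0 /\ w' m = 0 \/
    thr (lev w' 0 m) k + w m = thr (lev w 0 m) k + w' m).
Proof.
move=> wk wk' rw rw' mn [p [q [pi [[piK sz bp h] lam Pp Qq]]]].
have [_ _ G] := gb; have pk2 := wk m; have qk2 := wk' m.
have h2 : pat ((w m, w' m) :: (p, q) :: pi) R (val w m) (val w' m).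
  apply/(G m true); rewrite //; have [s1 a1] := piK; split=> //; lia.
have [/= _ /andP[/andP[pk qk] al]] := piK.
have bp2 : bijmod (D k) (pat ((w m, w' m) :: (p, q) :: pi) R).
  by apply: bijmod_step => // *; apply: Dabsorb.
have bef d := @insert_before _ _ d _ _ _ _ wk wk' pk2 qk2 bp2 h2.
have aft d := @insert_after _ _ d _ _ _ _ wk wk' pk2 qk2 piK bp erefl erefl h2.
have lk := lev_le 0 m wk; have lk' := lev_le 0 m wk'.
have l0 : 0 < thr (lev w 0 m) k by apply: thr_gt0 => //; apply/maxn_idPr.
have l0' : 0 < thr (lev w' 0 m) k by apply: thr_gt0 => //; apply/maxn_idPr.
have eP : lev w 0 m.+1 = maxn (lev w 0 m) (w m) by rewrite levS.
have eQ : lev w' 0 m.+1 = maxn (lev w' 0 m) (w' m) by rewrite levS.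
have lP := rw _ mn; have lQ := rw' _ mn.
have z : w m = 0 <-> w' m = 0.
  by split=> e; have := bef 0; rewrite !subn0 e; [move: lQ|move: lP]; lia.
have [p0|p0] := eqVneq (w m) 0.
  have q0 := z.1 p0; split; last by left.
  move: h2 eP eQ; rewrite p0 q0 !maxn0 [X in X -> _]/= step0 // => h2 eP eQ.
  by exists p, q, pi; rewrite -eP -eQ.
have {}lP : thr (lev w 0 m) k <= w m by apply: lP; apply/eqP.
have {}lQ : thr (lev w' 0 m) k <= w' m by apply: lQ => /z /eqP; rewrite (negbTE p0).
have lam2 := gap_eq l0' lP bef l0.
split; last by right.
(* If [w m] also reaches the threshold behind it, [aft] gives the new pair the same difference as
   (p, q), and the two merge. Otherwise [w m] exceeds all earlier letters and the pair is kept; the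
   drop of [lev] pays for the longer pattern. *)
have [lp|pl] := leqP (thr (lev w 0 m.+1) k) (w m).
  have l0m : 0 < thr (lev w 0 m.+1) k.
    by apply: thr_gt0 => //; [exact: lev_le|apply/maxn_idPr/lev_le].
  have l0m' : 0 < thr (lev w' 0 m.+1) k.
    by apply: thr_gt0 => //; [exact: lev_le|apply/maxn_idPr/lev_le].
  have lam3 := gap_eq l0m' lp aft l0m.
  have e : w m + q = w' m + p by lia.
  exists p, q, pi; split; [split=> //|by lia|by lia|by lia].
    by lia.
  have wp : w m <= p by lia.
  move: h2 => /=; rewrite step_merge //; case: ifP => // pw.
  have pe : p = w m by lia.
  have qe : q = w' m by lia.
  by rewrite pe qe.
have Pw : lev w 0 m < w m.
  rewrite ltnNge; apply/negP => wP; move: pl; rewrite eP (maxn_idPl wP); lia.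
have := aft 0; rewrite !subn0 => -[/(_ pl) ql _].
have Qw : lev w' 0 m < w' m.
  rewrite ltnNge; apply/negP => wQ; move: ql; rewrite eQ (maxn_idPl wQ); lia.
have szp : (size pi).+2 + lev w 0 m <= k.+1 by move: sz; rewrite /= eP; lia.
exists (w m), (w' m), ((p, q) :: pi); split=> //; [split=> //|by lia|by lia].
by split=> /=; [lia|rewrite pk2 qk2 pk qk].
Qed.

(** The scan from the right supplies an equation between thresholds and letters at every place. Read
    from the left, equal prefixes have equal thresholds and force equal letters. *)
Lemma left_reduced_inj w w' n : word w -> word w' ->
  left_reduced w n -> left_reduced w' n -> D k (val w n) (val w' n) ->
  forall j, j < n -> w j = w' j.
Proof.
move=> wk wk' rw rw' h.
have ch d : d <= n -> chain w w' (n - d).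
  elim: d => [|d IH] dn; first by rewrite subn0; apply: chain_start.
  have e : n - d = (n - d.+1).+1 by lia.
  have := IH (ltnW dn); rewrite e => c.
  by apply: (proj1 (chain_step wk wk' rw rw' _ c)); lia.
elim/ltn_ind => j IH jn.
have := ch (n - j.+1); rewrite subKn // => /(_ (leq_subr _ _)) cj.
have [_ [[-> ->] //|]] := chain_step wk wk' rw rw' jn cj.
have -> : lev w' 0 j = lev w 0 j.
  by apply/esym/eq_lev => i ij; apply: IH; lia.
by move/addnI.
Qed.

Definition upd (w : nat -> nat) (j c : nat) : nat -> nat :=
  fun i => if i == j then c else w i.

Lemma upd_eq w j c : upd w j c j = c.
Proof. by rewrite /upd eqxx. Qed.

Lemma upd_neq w j c i : i <> j -> upd w j c i = w i.
Proof. by rewrite /upd; case: eqP. Qed.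

Lemma word_upd w j c : word w -> c <= k -> word (upd w j c).
Proof. by move=> wk ck i; rewrite /upd; case: ifP. Qed.

Lemma lev_cat w i m n : i <= m -> m <= n -> lev w i n = maxn (lev w i m) (lev w m n).
Proof. by move=> im mn; rewrite /lev -big_cat_nat. Qed.

Lemma lev1 w m : lev w m m.+1 = w m.
Proof. by rewrite levS // lev_nil max0n. Qed.

Lemma lev_ge w m n j : m <= j < n -> w j <= lev w m n.
Proof.
move=> /andP[mj jn]; rewrite (@lev_cat w m j) //; last by lia.
by rewrite (@lev_cat w j j.+1) // lev1; lia.
Qed.

Lemma lev_attained w m n : 0 < lev w m n -> exists2 j, m <= j < n & w j = lev w m n.
Proof.
elim: n => [|n IH]; first by rewrite /lev big_geq.
have [mn|nm] := leqP m n; last by rewrite /lev big_geq.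
rewrite levS // => h; have [ln|nl] := leqP (w n) (lev w m n).
  move: h; rewrite (maxn_idPl ln) => h.
  by have [j jn e] := IH h; exists j => //; lia.
by exists n; lia.
Qed.

Lemma lev_upd_out w j c m n : ~~ (m <= j < n) -> lev (upd w j c) m n = lev w m n.
Proof.
move=> jn; apply: eq_lev => i hi; rewrite upd_neq // => e.
by rewrite e in hi; rewrite hi in jn.
Qed.

Lemma lev_around w j n : j < n -> lev w 0 n = maxn (maxn (lev w 0 j) (w j)) (lev w j.+1 n).
Proof. by move=> jn; rewrite (@lev_cat w 0 j.+1) // levS. Qed.

Lemma erase_rel a w i m : word w -> a <= k -> i < m ->
  D a (val w m) (val (upd w i 0) m) <->
  negligible (lev w 0 i) (maxn a (lev w i.+1 m)) (w i).
Proof.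
move=> wk ak im; have wk' : word (upd w i 0) by apply: word_upd.
have := @pat_common true a i.+1 (m - i.+1) w (upd w i 0) [::] wk wk'.
rewrite subnKC //= => ->; last first.
- by move=> j hj; rewrite upd_neq //; lia.
- by split; rewrite //= ak.
set c := maxn a _; have ck : c <= k by rewrite geq_max ak lev_le.
have [_ _ /(_ i true [:: (c, c)] _ _ wk wk') /= <-] := gb; last first.
  by split; rewrite //= ck.
rewrite upd_eq (_ : val (upd w i 0) i = val w i) ?erase_level //.
by apply: eq_val => // j ji; rewrite upd_neq //; lia.
Qed.

Definition full w n := lev w 0 n = k.

(** The third condition keeps the shortened word in FIN_k and is what [thrP] asks for. *)
Definition deletable w j n :=
  [/\ j < n, w j <> 0, lev w 0 j = k \/ lev w j.+1 n = k
    & w j < thr (lev w 0 j) (lev w j.+1 n)].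

Definition reduced w n := forall j, ~ deletable w j n.

Lemma maxn_eq_l x y : x <= k -> y <= k -> x = k \/ y = k -> maxn x y = k.
Proof. by move=> xk yk []; lia. Qed.

Lemma deletable_rel w j n : word w -> deletable w j n ->
  R (val w n) (val (upd w j 0) n).
Proof.
move=> wk [jn wj kk lt]; rewrite -[R _ _](step0 tU).
apply/erase_rel => //; rewrite max0n; apply/thrP => //; try exact: lev_le.
by apply: maxn_eq_l => //; exact: lev_le.
Qed.

Lemma deletable_full w j n : word w -> deletable w j n -> full (upd w j 0) n.
Proof.
move=> wk [jn wj kk _]; rewrite /full (@lev_around _ j) // upd_eq.
rewrite !lev_upd_out ?ltnn ?andbF //; have := lev_le 0 j wk; have := lev_le j.+1 n wk.
by lia.
Qed.

(** The last clause is induction along the deletions in impredicative form; it later carries the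
    R-class and the visible map together from w to [w0]. *)
Lemma reduction_exists w n : word w -> full w n ->
  exists w0, [/\ word w0, full w0 n, reduced w0 n
    & forall P : (nat -> nat) -> Prop, P w ->
      (forall x j, word x -> full x n -> deletable x j n -> P x -> P (upd x j 0)) ->
      P w0].
Proof.
have [m] := ubnP (count (fun j => w j != 0) (iota 0 n)).
elim: m w => // m IH w cm wk wn.
have [[j dj]|nd] := pselect (exists j, deletable w j n); last first.
  by exists w; split=> // j dj; apply: nd; exists j.
have lt : count (fun l => upd w j 0 l != 0) (iota 0 n) < m.
  have [jn wj _ _] := dj; rewrite ltnS in cm; apply: leq_trans cm.
  have -> : iota 0 n = iota 0 j ++ j :: iota j.+1 (n - j.+1).
    by rewrite -[in LHS](subnKC jn) addSnnS iotaD.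
  rewrite !count_cat /= upd_eq eqxx add0n (introN eqP wj) add1n addnS ltnS leq_eqVlt.
  apply/orP; left; apply/eqP; congr (_ + _); apply: eq_in_count => i;
  by rewrite mem_iota => hi; rewrite upd_neq //; lia.
have [w0 [w0k w0n w0r w0P]] := IH _ lt (word_upd j wk (leq0n k)) (deletable_full wk dj).
exists w0; split=> // P Pw Pd; apply: w0P => //.
exact: Pd.
Qed.

(* By reduced_floating such words arise when the place of a letter k is immaterial. *)
Definition siblings w w' n := exists x i j, [/\ [/\ word x, full x n,
    deletable x i n & deletable x j n],
    forall l, l < n -> upd x i 0 l = w l & forall l, l < n -> upd x j 0 l = w' l].

Lemma siblings_sym w w' n : siblings w w' n -> siblings w' w n.
Proof. by move=> [x [i [j [[? ? ? ?] ? ?]]]]; exists x, j, i. Qed.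

Lemma last_difference (w w' : nat -> nat) n : (forall j, j < n -> w j = w' j) \/
  exists j, [/\ j < n, w j <> w' j & forall i, j < i < n -> w i = w' i].
Proof.
elim: n => [|n IH]; first by left.
have [e|ne] := eqVneq (w n) (w' n); last first.
  by right; exists n; split=> //; [apply/eqP|move=> i; lia].
have [h|[j [jn wj h]]] := IH.
  by left=> j; rewrite ltnS leq_eqVlt => /orP[/eqP ->|/h].
right; exists j; split=> //; [lia|move=> i].
by have [->|ni] := eqVneq i n => // hi; apply: h; lia.
Qed.

Lemma reduced_letter w j n : word w -> reduced w n -> j < n -> w j <> 0 ->
  lev w 0 j = k \/ lev w j.+1 n = k -> thr (lev w 0 j) (lev w j.+1 n) <= w j.
Proof.
move=> wk rw jn wj kk; rewrite leqNgt; apply/negP => lt.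
by apply: (rw j); split.
Qed.

Lemma lev_suffix w i m n : i <= m -> m <= n -> word w -> lev w m n = k -> lev w i n = k.
Proof.
by move=> im mn wk h; have := lev_le i n wk; rewrite (lev_cat w im mn) h; lia.
Qed.

(** Left of j, the word w' turns out to be w with its first letter k deleted. Hence both arise from
    w with an additional k at j. *)
Lemma reduced_floating w w' j n : 0 < k -> word w -> word w' -> full w n -> full w' n ->
  reduced w n -> reduced w' n -> j < n -> (forall i, j < i < n -> w i = w' i) ->
  w j = 0 -> w' j = k -> lev w 0 j = k -> lev w' 0 j < k ->
  k < thr k (lev w j.+1 n) -> D (lev w j.+1 n) (val w j.+1) (val w' j.+1) ->
  siblings w w' n.
Proof.
move=> k0 wk wk' wn wn' rw rw' jn ww wj wj' P Q.
set c := lev w j.+1 n => thk h; have ck : c <= k by exact: lev_le.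
(* A negligible k is inserted into w at j; then both words continue with k and c, and k absorbs
   c. *)
have Dkj : D k (val w j) (val w' j).
  have h1 : step 0 k (D c) (val w j) (val w' j).
    have [_ _ /(_ j true [:: (c, c)] w w' wk wk')] := gb; rewrite wj wj' /=.
    by case; [split; rewrite //= ck|move=> _; apply].
  have h2 : step k 0 (D c) (val w j) (val w j).
    by apply/erase_level => //; rewrite P; apply/thrP => //; apply/maxn_idPl.
  rewrite -[k in D k](maxn_idPl ck) -step_max //.
  by move: h2 h1; apply: filterS2 => x; apply: Dtrans.
have thc c' : c <= c' -> c' <= k -> k < thr k c'.
  by move=> cc ck'; rewrite (thr_persist_right tU Rsym Rtrans cc) //; lia.
have ex : exists i, (i < j) && (w i == k).
  by have [|i ij e] := @lev_attained w 0 j; [lia|exists i; lia].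
have [i /andP[ij /eqP wi] imin] := ex_minnP ex.
have zer l : i < l -> l < j -> w l = 0.
  move=> il lj; apply: contrapT => wl.
  have Pl : lev w 0 l = k.
    by have := lev_le 0 l wk; have := @lev_ge w 0 l i; rewrite wi; lia.
  have := reduced_letter wk rw (ltn_trans lj jn) wl (or_introl Pl).
  rewrite Pl leqNgt => /negP; apply; apply: leq_ltn_trans (wk l) (thc _ _ (lev_le _ _ wk)).
  by rewrite (@lev_cat w l.+1 j.+1 n) ?leq_maxr //; lia.
have a_lt : lev w 0 i < k.
  rewrite ltnNge; apply/negP => ge.
  have [|l li e] := @lev_attained w 0 i; first by lia.
  by have := imin l; rewrite e; have := lev_le 0 i wk; lia.
have leftw l : l < i -> w l <> 0 -> thr (lev w 0 l) k <= w l.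
  move=> li wl; have s : lev w l.+1 n = k.
    have := lev_le l.+1 n wk; have := @lev_ge w l.+1 n i; rewrite wi; lia.
  by have := reduced_letter wk rw _ wl (or_intror s); rewrite s; apply; lia.
have leftw' : left_reduced w' j.
  move=> l lj wl; have s : lev w' l.+1 n = k.
    have := lev_le l.+1 n wk'; have := @lev_ge w' l.+1 n j; rewrite wj'; lia.
  by have := reduced_letter wk' rw' _ wl (or_intror s); rewrite s; apply; lia.
(* Otherwise w is left reduced up to j, hence equal to w' there, although their levels before j
   differ. *)
have tha : k < thr (lev w 0 i) k.
  rewrite ltnNge; apply/negP => le.
  have leftwj : left_reduced w j.
    move=> l lj wl; have [li|il|->] := ltngtP l i; first exact: leftw.
      by case: wl; apply: zer.
    by rewrite wi.
  have e := left_reduced_inj wk wk' leftwj leftw' Dkj.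
  have el : lev w 0 j = lev w' 0 j by apply: eq_lev => l hl; apply: e; lia.
  by lia.
have w0k : word (upd w i 0) by apply: word_upd.
have e0 l : l < j -> upd w i 0 l = w' l.
  apply: left_reduced_inj => //.
    move=> m mj; have [mi|im|->] := ltngtP m i; last by rewrite upd_eq.
      rewrite upd_neq; last by lia.
      by move=> wm; rewrite lev_upd_out ?leftw //; lia.
    by rewrite upd_neq ?zer //; lia.
  apply: Dtrans Dkj; apply: Dsym; apply/erase_rel => //.
  have -> : maxn k (lev w i.+1 j) = k by apply/maxn_idPl/lev_le.
  by rewrite wi; apply/thrP => //; [exact: lev_le|apply/maxn_idPr/lev_le].
have xk : word (upd w j k) by apply: word_upd.
exists (upd w j k), j, i; split; first split=> //.
- have := lev_le 0 n xk; have := @lev_ge (upd w j k) 0 n j; rewrite upd_eq /full; lia.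
- split=> //; rewrite ?upd_eq ?lev_upd_out ?P //; try lia.
- have s : lev (upd w j k) i.+1 n = k.
    have := lev_le i.+1 n xk; have := @lev_ge (upd w j k) i.+1 n j; rewrite upd_eq; lia.
  split; rewrite ?s ?upd_neq ?wi ?lev_upd_out //; try lia.
- move=> l ln; have [->|lj] := eqVneq l j; first by rewrite upd_eq.
  by rewrite !upd_neq //; apply/eqP.
- move=> l ln; have [lj|jl|->] := ltngtP l j.
  + rewrite -e0 //; have [->|li] := eqVneq l i; first by rewrite !upd_eq.
    by rewrite /upd (negbTE li) (ltn_eqF lj).
  + by rewrite !upd_neq ?ww //; lia.
  + by rewrite upd_neq ?upd_eq //; lia.
Qed.

Lemma related_reduced w w' n : 0 < k -> word w -> word w' -> full w n -> full w' n ->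
  reduced w n -> reduced w' n -> R (val w n) (val w' n) ->
  (forall j, j < n -> w j = w' j) \/ siblings w w' n.
Proof.
move=> k0 wk wk' wn wn' rw rw' h.
have [|[j [jn wj ww]]] := last_difference w w' n; first by left.
have sE : lev w j.+1 n = lev w' j.+1 n by apply: eq_lev => i hi; apply: ww; lia.
have {}h : D (lev w j.+1 n) (val w j.+1) (val w' j.+1).
  by apply/rel_common => // i hi; apply: ww; lia.
(* With a letter k to the right of j, both prefixes are left reduced and therefore equal. *)
have [ck|ck] := eqVneq (lev w j.+1 n) k.
  have lr x : word x -> reduced x n -> lev x j.+1 n = k -> left_reduced x j.+1.
    move=> xk rx s l lj xl; have s' : lev x l.+1 n = k by apply: lev_suffix s => //; lia.
    by have := reduced_letter xk rx _ xl (or_intror s'); rewrite s'; apply; lia.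
  rewrite ck in h; case: wj; apply: (@left_reduced_inj w w' j.+1) => //; apply: lr => //.
  by rewrite -sE.
set c := lev w j.+1 n in sE h ck; have ck' : c < k by have := lev_le j.+1 n wk; lia.
have lw : lev w 0 j.+1 = k.
  by move: wn; rewrite /full (@lev_cat w 0 j.+1) // -/c; lia.
have lw' : lev w' 0 j.+1 = k.
  by move: wn'; rewrite /full (@lev_cat w' 0 j.+1) // -sE; lia.
have pk := wk j; have qk := wk' j; have [_ _ G] := gb; have ck2 := ltnW ck'.
(* The tail is common, so both letters face the same threshold; if one reaches it, [gap_eq] makes
   them equal. Below it, reducedness leaves only 0 after a level k, and a letter k otherwise. *)
have aft d : w j - d < thr k c <-> w' j - d < thr k c.
  have mk : maxn k c = k by apply/maxn_idPl.
  rewrite !thrP //; try lia.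
  have eP := @erase_level j.+1 w c (w j - d) wk ck2 (leq_trans (leq_subr _ _) pk).
  have eQ := @erase_level j.+1 w' c (w' j - d) wk' ck2 (leq_trans (leq_subr _ _) qk).
  rewrite lw in eP; rewrite lw' in eQ; rewrite -eP -eQ.
  apply: (bijmod_insert tU (bijmod_refl (@Dsym c) (@Dtrans c)) (@Drefl c) h).
  apply/(G j true [:: (w j - d, w' j - d); (c, c)] w w' wk wk').
    by split; rewrite //= ck2; lia.
  rewrite /= step_after //; apply/(G j true [:: (c, c)] w w' wk wk') => //.
  by split; rewrite //= ck2.
have l0 : 0 < thr k c by apply: thr_gt0 => //; apply/maxn_idPl.
have pl : w j < thr k c.
  rewrite ltnNge; apply/negP => le; have := gap_eq l0 le aft l0; lia.
have ql : w' j < thr k c by have := aft 0; rewrite !subn0 => -[] ->.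
have Pp : lev w 0 j = k -> w j = 0.
  move=> P; apply: contrapT => w0.
  by have := reduced_letter wk rw jn w0 (or_introl P); rewrite P -/c; lia.
have Qq : lev w' 0 j = k -> w' j = 0.
  move=> P; apply: contrapT => w0.
  by have := reduced_letter wk' rw' jn w0 (or_introl P); rewrite P -sE; lia.
move: lw lw'; rewrite !levS // => lw lw'.
have [P|P] := eqVneq (lev w 0 j) k; have [Q|Q] := eqVneq (lev w' 0 j) k.
- by case: wj; rewrite Pp // Qq.
- right; apply: (@reduced_floating _ _ j) => //; [exact: Pp|lia|lia|rewrite -/c; lia].
- right; apply/siblings_sym/(@reduced_floating _ _ j) => //.
  + by move=> i hi; rewrite ww.
  + exact: Qq.
  + by lia.
  + by lia.
  + by rewrite -sE; lia.
  + by rewrite -sE; apply: Dsym.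
- by lia.
Qed.

End GenericWords.

(** * Staircases *)

Section Vectors.
Variable k : nat.

(** The maximum runs over the finitely many values instead of P, which may be infinite. *)
Definition smax (P : set nat) (s : vec) : nat :=
  \max_(a < k.+1 | `[< exists y, P y /\ s y = a >]) a.

Lemma smax_le P s : smax P s <= k.
Proof. by apply/bigmax_leqP => a _; rewrite -ltnS. Qed.

Lemma le_smax P s y : s y <= k -> P y -> s y <= smax P s.
Proof.
rewrite -ltnS => sk Py; apply: (leq_bigmax_cond (Ordinal sk)).
by apply/asboolP; exists y.
Qed.

Lemma smax_attained P s : 0 < smax P s -> exists y, P y /\ s y = smax P s.
Proof.
rewrite /smax; apply: (big_ind (fun c => 0 < c -> exists y, P y /\ s y = c)) => //.
  by move=> x y hx hy; case: (leqP y x).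
by move=> a /asboolP.
Qed.

Lemma smaxP P s c : (forall y, P y -> s y <= c) -> c <= k ->
  (0 < c -> exists y, P y /\ s y = c) -> smax P s = c.
Proof.
move=> ub ck at_; apply/eqP; rewrite eqn_leq; apply/andP; split.
  case: (posnP (smax P s)) => [-> //|/smax_attained [y [Py <-]]]; exact: ub.
case: (posnP c) => [-> //|/at_ [y [Py e]]]; rewrite -[X in X <= _]e.
by apply: le_smax => //; rewrite e.
Qed.

Definition pm (s : vec) (x : nat) := smax [set y | y < x] s.
Definition sm (s : vec) (x : nat) := smax [set y | x < y] s.

(** A form of sos in terms of the maxima before and after a position, from which thresholds are
    read. For generic vectors it follows by splitting into three letters. *)
Definition stair (s : vec) : Prop := forall a l, 0 < a -> a <= k -> l <= a ->
  (exists x, [/\ pm s x = a, sm s x = k & s x = l]) /\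
  (exists x, [/\ pm s x = k, sm s x = a & s x = l]).

Lemma stair_max s x : 0 < k -> stair s -> pm s x = k \/ sm s x = k.
Proof.
move=> k0 st; have [[z [pz sz _]] _] := st k k k0 (leqnn k) (leqnn k).
have [|y [yz sy]] := @smax_attained [set y | y < z] s; first by rewrite -/(pm s z) pz.
have [|y' [yz' sy']] := @smax_attained [set y | z < y] s; first by rewrite -/(sm s z) sz.
have [zx|xz] := leqP z x; [left|right]; apply/eqP; rewrite eqn_leq smax_le /=.
  by rewrite -[X in X <= _]pz /pm -sy le_smax //= ?sy ?smax_le //; exact: leq_trans zx.
by rewrite -[X in X <= _]sz /sm -sy' le_smax //= ?sy' ?smax_le //; exact: ltn_trans xz _.
Qed.

(* Used with ltn and minat, and with gtn and maxat, for the two flanks. *)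
Section OneSide.
Variables (lt : rel nat) (s : vec) (first : nat -> nat).
Hypothesis ltT : transitive lt.
Hypothesis ltC : forall x y, [\/ lt x y, x = y | lt y x].
Hypothesis sk : forall x, s x <= k.
Let pre x := smax [set y | lt y x] s.
Let suf x := smax [set y | lt x y] s.
Hypothesis firstP : forall i, 0 < i -> i <= k -> s (first i) = i /\
  forall y, s y = i -> ~~ lt y (first i).
Hypothesis st : forall a l, 0 < a -> a <= k -> l <= a ->
  exists x, [/\ pre x = a, suf x = k & s x = l].

Lemma first_lt a x : 0 < a -> pre x = a -> lt (first a) x.
Proof.
move=> a0 ax; have [|y [yx sy]] := @smax_attained [set y | lt y x] s.
  by rewrite -/(pre x) ax.
have ak : a <= k by rewrite -ax smax_le.
have [_ /(_ y) h] := firstP a0 ak; have [h1|->//|h1] := ltC (first a) y.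
  exact: ltT h1 yx.
by move: h; rewrite sy -/(pre x) ax h1 => /(_ erefl).
Qed.

Lemma lt_first j x : pre x < j -> s x < j -> j <= k -> lt x (first j).
Proof.
move=> xj sj jk; have [e _] := firstP (leq_ltn_trans (leq0n _) xj) jk.
have [//|xe|jx] := ltC x (first j); first by move: sj; rewrite xe e ltnn.
have := @le_smax [set y | lt y x] s (first j) (sk _) jx.
by rewrite e -/(pre x) leqNgt xj.
Qed.

Lemma first_mono i j : 0 < i -> i < j -> j <= k -> lt (first i) (first j).
Proof.
move=> i0 ij jk; have ik : i <= k by exact: ltnW (leq_trans ij jk).
have [x [px _ sx]] := st i0 ik (leq0n i).
apply: (@ltT x); first by apply: first_lt; rewrite ?px.
by apply: lt_first => //; rewrite ?px ?sx //; exact: leq_ltn_trans ij.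
Qed.

Lemma before_first i y : 0 < i -> i <= k -> lt y (first i) -> s y < i.
Proof.
move=> i0 ik yi; rewrite ltnNge; apply/negP => isy.
have s0 : 0 < s y by exact: leq_trans isy.
have [_ /(_ y erefl) h] := firstP s0 (sk y).
move: isy; rewrite leq_eqVlt => /orP[/eqP e|lt_i].
  by move: h; rewrite -e yi.
by move: h; rewrite (ltT yi (first_mono i0 lt_i (sk y))).
Qed.

Lemma pre_first i : 0 < i -> i <= k -> pre (first i) = i.-1 /\ suf (first i) = k.
Proof.
move=> i0 ik; split.
  apply: smaxP; [|lia|].
    by move=> y /(before_first i0 ik); lia.
  move=> i1; exists (first i.-1); split; first by apply: first_mono; lia.
  by have [] := @firstP i.-1; lia.
apply: smaxP => // k0.
move: ik; rewrite leq_eqVlt => /orP[/eqP e|ik].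
  rewrite e; have [x [px sx _]] := st k0 (leqnn k) (leq0n k).
  have [|y [xy sy]] := @smax_attained [set y | lt x y] s; first by rewrite -/(suf x) sx.
  exists y; split; last by rewrite sy -/(suf x).
  by apply: ltT xy; apply: first_lt; rewrite ?px.
exists (first k); split; first exact: first_mono.
by have [] := firstP k0 (leqnn k).
Qed.

Lemma between_first i x : 1 < i -> i <= k -> lt (first i.-1) x -> lt x (first i) ->
  pre x = i.-1 /\ suf x = k.
Proof.
move=> i1 ik h1 h2; split.
  apply: smaxP; [|lia|].
    by move=> y yx; have := before_first (ltnW i1) ik (ltT yx h2); lia.
  by move=> _; exists (first i.-1); split=> //; have [] := @firstP i.-1; lia.
apply: smaxP => // k0; exists (first k); split; last by have [] := firstP k0 (leqnn k).
move: ik; rewrite leq_eqVlt => /orP[/eqP <- //|ik].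
by apply: ltT h2 _; apply: first_mono; lia.
Qed.

Lemma record_first x : pre x < s x -> x = first (s x) /\ pre x = (s x).-1.
Proof.
move=> h; have s0 : 0 < s x by exact: leq_ltn_trans h.
have [e n] := firstP s0 (sk x); have xe : x = first (s x).
  have [h1|//|h1] := ltC x (first (s x)).
    by have := n x erefl; rewrite h1.
  have := @le_smax [set y | lt y x] s (first (s x)) (sk _) h1.
  by rewrite e -/(pre x) leqNgt h.
by split=> //; rewrite {1}xe (pre_first s0 (sk x)).1.
Qed.

End OneSide.

Lemma minsetE (P : set nat) m : P m -> (forall y, P y -> m <= y) -> Defs.minset P = m.
Proof.
move=> Pm mP; apply: xget_unique => [|y [Py yP]].
  by split=> // y; rewrite leEnat; apply: mP.
by apply/eqP; rewrite eqn_leq (mP y Py); have := yP m Pm; rewrite leEnat => ->.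
Qed.

Lemma maxsetE (P : set nat) m : P m -> (forall y, P y -> y <= m) -> Defs.maxset P = m.
Proof.
move=> Pm mP; apply: xget_unique => [|y [Py yP]].
  by split=> // y; rewrite leEnat; apply: mP.
by apply/eqP; rewrite eqn_leq (mP y Py); have := yP m Pm; rewrite leEnat => ->.
Qed.

Lemma minatP s i : (exists y, s y = i) ->
  s (minat i s) = i /\ forall y, s y = i -> minat i s <= y.
Proof.
move=> [y sy]; have ex : exists y, s y == i by exists y; apply/eqP.
have [m /eqP sm_ mmin] := ex_minnP ex; have -> : minat i s = m.
  by apply: minsetE => // z /eqP /mmin.
by split=> // z /eqP /mmin.
Qed.

Lemma maxatP s i N : 0 < i -> (forall n, N <= n -> s n = 0) -> (exists y, s y = i) ->
  s (maxat i s) = i /\ forall y, s y = i -> y <= maxat i s.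
Proof.
move=> i0 sN [y sy]; have ex : exists y, s y == i by exists y; apply/eqP.
have bd z : s z == i -> z <= N.
  by move=> /eqP e; rewrite leqNgt; apply/negP => /ltnW /sN; lia.
have [m /eqP sm_ mmax] := ex_maxnP ex bd; have -> : maxat i s = m.
  by apply: maxsetE => // z /eqP /mmax.
by split=> // z /eqP /mmax.
Qed.

Definition piece (t i l : nat) : vec -> vec :=
  match t with
  | 0 => minmap i
  | 1 => maxmap i
  | 2 => theta0 i l
  | 3 => theta1 i l
  | _ => theta2 k l
  end.

(** The arguments of [th] are the maxima before and after the points of the piece. They are constant
    on it, so a threshold condition selects whole pieces. *)
Definition enabled (th : nat -> nat -> nat) (t i l : nat) : bool :=
  match t with
  | 0 => [&& 1 <= i, i <= k & th i.-1 k <= i]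
  | 1 => [&& 1 <= i, i <= k & th k i.-1 <= i]
  | 2 => [&& 2 <= i, i <= k, 1 <= l, l <= i.-1 & th i.-1 k <= l]
  | 3 => [&& 2 <= i, i <= k, 1 <= l, l <= i.-1 & th k i.-1 <= l]
  | _ => [&& 1 <= l, l <= k & th k k <= l]
  end.

Definition visible_map (th : nat -> nat -> nat) (s : vec) : vec :=
  fun x => if th (pm s x) (sm s x) <= s x then s x else 0.

Definition staircase_map (th : nat -> nat -> nat) (s : vec) : vec := fun x =>
  \max_(t < 5) \max_(i < k.+1) \max_(l < k.+1)
    (if enabled th t i l then piece t i l s x else 0).

Lemma closure_max (I : Type) (r : seq I) (f : I -> vec -> vec) :
  (forall i, lattice_closure (basic_map k) (f i)) ->
  lattice_closure (basic_map k) (fun s x => \max_(i <- r) f i s x).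
Proof.
move=> cf; elim: r => [|i r IH].
  rewrite (_ : (fun _ _ => _) = fun _ _ => 0); first exact/closure_base/basic_zero.
  by apply/funext => s; apply/funext => x; rewrite big_nil.
rewrite (_ : (fun _ _ => _) =
    fun s => vjoin (f i s) (fun x => \max_(j <- r) f j s x)); first exact: closure_join.
by apply/funext => s; apply/funext => x; rewrite big_cons.
Qed.

Lemma staircase_map_closure th : lattice_closure (basic_map k) (staircase_map th).
Proof.
apply: closure_max => t; apply: closure_max => i; apply: closure_max => l.
case en: (enabled th t i l); last exact/closure_base/basic_zero.
apply: closure_base; move: en; rewrite /piece /enabled.
case: (nat_of_ord t) => [|[|[|[|_]]]].
- by move=> /and3P[i0 ik _]; apply: basic_min.
- by move=> /and3P[i0 ik _]; apply: basic_max.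
- by move=> /and5P[i0 ik l0 li _]; apply: basic_theta0.
- by move=> /and5P[i0 ik l0 li _]; apply: basic_theta1.
- by move=> /and3P[l0 lk _]; apply: basic_theta2.
Qed.

Section Staircase.
Variables (s : vec) (N : nat).
Hypothesis k0 : 0 < k.
Hypothesis sk : forall x, s x <= k.
Hypothesis sN : forall n, N <= n -> s n = 0.
Hypothesis st : stair s.

Let attained i : 0 < i -> i <= k -> exists y, s y = i.
Proof. by move=> i0 ik; have [[x [_ _ e]] _] := st i0 ik (leqnn i); exists x. Qed.

Let minP i : 0 < i -> i <= k -> s (minat i s) = i /\
  forall y, s y = i -> ~~ (y < minat i s).
Proof.
move=> i0 ik; have [e h] := minatP (attained i0 ik); split=> // y /h.
by rewrite leqNgt.
Qed.

Let maxP i : 0 < i -> i <= k -> s (maxat i s) = i /\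
  forall y, s y = i -> ~~ gtn y (maxat i s).
Proof.
move=> i0 ik; have [e h] := maxatP i0 sN (attained i0 ik); split=> // y /h.
by rewrite leqNgt.
Qed.

Let ltnC x y : [\/ x < y, x = y | y < x].
Proof. by case: (ltngtP x y) => h; [apply: Or31|apply: Or33|apply: Or32]. Qed.

Let gtnC x y : [\/ gtn x y, x = y | gtn y x].
Proof. by rewrite /=; case: (ltngtP x y) => h; [apply: Or33|apply: Or31|apply: Or32]. Qed.

Let gtnT : transitive gtn.
Proof. by move=> y x z /= h1 h2; apply: ltn_trans h2 h1. Qed.

Let stl a l : 0 < a -> a <= k -> l <= a ->
  exists x, [/\ pm s x = a, sm s x = k & s x = l].
Proof. by move=> a0 ak la; have [] := st a0 ak la. Qed.

Let str a l : 0 < a -> a <= k -> l <= a ->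
  exists x, [/\ sm s x = a, pm s x = k & s x = l].
Proof. by move=> a0 ak la; have [_ [x []]] := st a0 ak la; exists x. Qed.

Let min_mono := first_mono ltn_trans ltnC sk minP stl.
Let max_mono := first_mono gtnT gtnC sk maxP str.

Let min_le_max : minat k s < maxat k s.
Proof.
have [x [px sx _]] := stl k0 (leqnn k) (leq0n k).
have h1 := first_lt ltn_trans ltnC minP k0 px.
have h2 := first_lt gtnT gtnC maxP k0 sx.
exact: ltn_trans h1 h2.
Qed.

Lemma staircase_sos : sos k s.
Proof.
have kk := leqnn k; split.
- apply/seteqP; split=> [_ [x _ <-]|l lk]; first exact: sk.
  by have [x [_ _ e]] := stl k0 kk lk; exists x.
- move=> i j i0 ij jk; split; [exact: min_mono| |exact: max_mono].
  have [<- //|jk'] := eqVneq k j.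
  apply: (@ltn_trans (minat k s)); first by apply: min_mono; lia.
  by apply: ltn_trans min_le_max _; apply: max_mono; lia.
- move=> i i1 ik; split; apply/seteqP; split.
  + move=> _ [n /andP[_ h] <-].
    by have := before_first ltn_trans ltnC sk minP stl (ltnW i1) ik h => /=; lia.
  + move=> l /= li; have [|||x [px sx e]] := @stl i.-1 l; try lia.
    exists x => //; apply/andP; split.
      by apply: (first_lt ltn_trans ltnC minP _ px); lia.
    by apply: (lt_first ltnC sk minP); rewrite -?/(pm s x) ?px; lia.
  + move=> _ [n /andP[h _] <-].
    by have := before_first gtnT gtnC sk maxP str (ltnW i1) ik h => /=; lia.
  + move=> l /= li; have [|||x [px sx e]] := @str i.-1 l; try lia.
    exists x => //; apply/andP; split.
      by apply: (lt_first gtnC sk maxP (x := x)); rewrite -?/(sm s x) ?px; lia.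
    by apply: (first_lt gtnT gtnC maxP _ px); lia.
- apply/seteqP; split=> [_ [x _ <-]|l lk]; first exact: sk.
  have [x [px sx e]] := stl k0 kk lk; exists x => //; apply/andP; split.
    exact: (first_lt ltn_trans ltnC minP k0 px).
  exact: (first_lt gtnT gtnC maxP k0 sx).
Qed.

Lemma pieceP th t i l x : enabled th t i l -> piece t i l s x <> 0 ->
  piece t i l s x = s x /\ th (pm s x) (sm s x) <= s x.
Proof.
have rg j : 0 < j -> j <= k -> range s j by move=> j0 jk; have [y] := attained j0 jk; exists y.
case: t => [|[|[|[|t]]]] /=; rewrite /minmap /maxmap /theta0 /theta1 /theta2 /level_on.
- move=> /and3P[i0 ik h]; case: asboolP => // -[/= xe e] _; split=> //.
  have [p q] := pre_first ltn_trans ltnC sk minP stl i0 ik.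
  by move: p q; rewrite -xe -/(pm s x) -/(sm s x) => -> ->; rewrite e.
- move=> /and3P[i0 ik h]; case: asboolP => // -[/= xe e] _; split=> //.
  have [p q] := pre_first gtnT gtnC sk maxP str i0 ik.
  by move: p q; rewrite -xe -/(pm s x) -/(sm s x) => -> ->; rewrite e.
- move=> /and5P[i0 ik l0 li h]; case: asboolP => // -[[/= _ _ /andP[h1 h2]] e] _; split=> //.
  have [p q] := between_first ltn_trans ltnC sk minP stl i0 ik h1 h2.
  by move: p q; rewrite -/(pm s x) -/(sm s x) => -> ->; rewrite e.
- move=> /and5P[i0 ik l0 li h]; case: asboolP => // -[[/= _ _ /andP[h1 h2]] e] _; split=> //.
  have [p q] := between_first gtnT gtnC sk maxP str i0 ik h2 h1.
  by move: p q; rewrite -/(pm s x) -/(sm s x) => -> ->; rewrite e.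
- move=> /and3P[l0 lk h]; case: asboolP => // -[[/= _ /andP[h1 h2]] e] _; split=> //.
  suff [-> ->] : pm s x = k /\ sm s x = k by rewrite e.
  split; apply: smaxP => // _.
    by exists (minat k s); split=> //; have [] := minP k0 (leqnn k).
  by exists (maxat k s); split=> //; have [] := maxP k0 (leqnn k).
Qed.

Lemma piece_exists th x : s x <> 0 -> th (pm s x) (sm s x) <= s x ->
  exists t i l, [/\ t < 5, i < k.+1, l < k.+1, enabled th t i l & piece t i l s x = s x].
Proof.
move=> sx0 vis; have rg j : 0 < j -> j <= k -> range s j.
  by move=> j0 jk; have [y] := attained j0 jk; exists y.
have sxk := sk x; have s0 : 0 < s x by lia.
have pk : pm s x <= k by exact: smax_le.
have qk : sm s x <= k by exact: smax_le.
(* By [stair_max] at least one of the two maxima is k. Which of them it is, and whether [s x]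
   exceeds the other one, determines the piece. *)
have [pe|pne] := eqVneq (pm s x) k; last first.
  have qe : sm s x = k by have [] := stair_max x k0 st => // e; rewrite e eqxx in pne.
  rewrite qe in vis; have [sp|ps] := leqP (s x) (pm s x).
    exists 2, (pm s x).+1, (s x); split=> //=; [lia|by rewrite vis s0 sp; lia|].
    rewrite /theta0 /level_on asboolT //=; split=> //; split; [apply: rg; lia|apply: rg; lia|].
    apply/andP; split; first by apply: (first_lt ltn_trans ltnC minP) => //; lia.
    by apply: (lt_first ltnC sk minP); rewrite -?/(pm s x); lia.
  have [xe px] := record_first ltn_trans ltnC sk minP stl ps.
  exists 0, (s x), 0; split=> //=.
    by rewrite s0 sxk; move: vis; rewrite [pm s x]px.
  by rewrite /minmap /level_on asboolT.
rewrite pe in vis; have [qe|qne] := eqVneq (sm s x) k.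
  rewrite qe in vis; exists 4, 0, (s x); split=> //=; first by rewrite s0 sxk.
  rewrite /theta2 /level_on asboolT //=; split=> //; split; first exact: rg.
  apply/andP; split; first by apply: (first_lt ltn_trans ltnC minP).
  by apply: (first_lt gtnT gtnC maxP).
have [sp|ps] := leqP (s x) (sm s x).
  exists 3, (sm s x).+1, (s x); split=> //=; [lia|by rewrite vis s0 sp; lia|].
  rewrite /theta1 /level_on asboolT //=; split=> //; split; [apply: rg; lia|apply: rg; lia|].
  apply/andP; split; last by apply: (first_lt gtnT gtnC maxP) => //; lia.
  by apply: (lt_first gtnC sk maxP (x := x)); rewrite -?/(sm s x); lia.
have [xe px] := record_first gtnT gtnC sk maxP str ps.
exists 1, (s x), 0; split=> //=.
  by rewrite s0 sxk; move: vis; rewrite [sm s x]px.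
by rewrite /maxmap /level_on asboolT.
Qed.

Lemma staircase_mapE th : staircase_map th s = visible_map th s.
Proof.
apply/funext => x; rewrite /visible_map; set v := if _ then _ else _.
apply/eqP; rewrite eqn_leq; apply/andP; split.
  apply/bigmax_leqP => t _; apply/bigmax_leqP => i _; apply/bigmax_leqP => l _.
  case: ifP => // en; have [-> //|/eqP ne] := eqVneq (piece t i l s x) 0.
  by have [-> h] := pieceP en ne; rewrite /v h.
rewrite /v; case: ifP => // vis; have [-> //|/eqP ne] := eqVneq (s x) 0.
have [t [i [l [t5 ik lk en e]]]] := piece_exists ne vis.
apply: leq_trans (leq_bigmax (Ordinal t5)).
apply: leq_trans (leq_bigmax (Ordinal ik)).
by apply: leq_trans (leq_bigmax (Ordinal lk)); rewrite en e.
Qed.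

End Staircase.
End Vectors.

(** * Thresholds under deletion of a letter *)

Section ThresholdArithmetic.
Variables (k : nat) (th : nat -> nat -> nat).
Hypothesis th_left : forall a a', a <= a' -> a' <= k -> a' < th a k -> th a' k = th a k.
Hypothesis th_right : forall c c', c <= c' -> c' <= k -> c' < th k c -> th k c' = th k c.

(** For positions inside the deleted block: one level is k, the other is raised at most to e, and
    persistence keeps its threshold. *)
Lemma th_inside pre suf e p q : pre = k \/ suf = k -> e < th pre suf ->
  p <= k -> q <= k -> pre <= p -> suf <= q -> p <= maxn pre e -> q <= maxn suf e ->
  e < th p q.
Proof.
move=> kk lt pk qk prp suq pm_ qm_; case: kk => [ek|ek]; rewrite ek in lt *.
  have -> : p = k by lia.
  have [->|ne] := eqVneq q suf; first by [].
  by rewrite (th_right suq) //; lia.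
have -> : q = k by lia.
have [->|ne] := eqVneq p pre; first by [].
by rewrite (th_left prp) //; lia.
Qed.

(** For positions behind the deleted block: a change needs p' < e. Then [suf] and q are k, both p'
    and e lie between [pre] and its threshold, and persistence gives them the same value. *)
Lemma th_after pre suf e p' q : pre = k \/ suf = k -> e < th pre suf -> e <= k ->
  p' <= k -> pre <= p' -> p' = k \/ q = k -> th (maxn p' e) q = th p' q.
Proof.
move=> kk lt ek pk prp pq; have [//|lt'] := leqP e p'.
have e1 : suf = k by lia.
have e2 : q = k by lia.
rewrite e1 in lt; rewrite e2.
by rewrite (th_left prp) //; [rewrite (@th_left pre e) //; lia|lia].
Qed.

Lemma th_before pre suf e p q' : pre = k \/ suf = k -> e < th pre suf -> e <= k ->
  q' <= k -> suf <= q' -> p = k \/ q' = k -> th p (maxn q' e) = th p q'.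
Proof.
move=> kk lt ek qk suq pq; have [//|lt'] := leqP e q'.
have e1 : pre = k by lia.
have e2 : p = k by lia.
rewrite e1 in lt; rewrite e2.
by rewrite (th_right suq) //; [rewrite (@th_right suf e) //; lia|lia].
Qed.

End ThresholdArithmetic.

Lemma eq_smax k P s s' : (forall y, P y -> s y = s' y) -> smax k P s = smax k P s'.
Proof.
move=> ss; apply: eq_bigl => a; apply: asbool_equiv_eq.
by split=> -[y [Py <-]]; exists y; split=> //; rewrite ss.
Qed.

(** * Visible letters *)

Section Blocks.
Variables (k : nat) (b : nat -> vec).
Hypothesis fb : forall n, fin k (b n).
Hypothesis sep : forall i j, i < j -> forall m m', b i m <> 0 -> b j m' <> 0 -> m < m'.

Local Notation val := (val k b).
Local Notation word := (word k).
Local Notation pm := (pm k).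
Local Notation sm := (sm k).

Lemma lv_le c j x : c <= k -> lv k c (b j) x <= c.
Proof. by move=> ck; have [bk _ _] := fb j; rewrite /lv /tetris; have := bk x; lia. Qed.

Lemma lv_nz c j x : lv k c (b j) x <> 0 -> b j x <> 0.
Proof. by rewrite /lv /tetris; lia. Qed.

Lemma peak j : exists2 x, b j x = k & forall c, c <= k -> lv k c (b j) x = c.
Proof.
have [_ _ [x e]] := fb j; exists x => // c ck.
by rewrite /lv /tetris e; lia.
Qed.

Lemma val_out w n x : (forall j, j < n -> b j x = 0) -> val w n x = 0.
Proof.
elim: n => //= n IH h; rewrite /vjoin IH; last by move=> j jn; apply: h; lia.
by rewrite /lv /tetris h // max0n.
Qed.

Lemma val_in w n j x : j < n -> b j x <> 0 -> val w n x = lv k (w j) (b j) x.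
Proof.
elim: n => //= n IH; rewrite ltnS leq_eqVlt => /orP[/eqP ->|jn] bj.
  rewrite /vjoin val_out ?max0n // => i ij; apply: contrapT => bi.
  by have := sep ij bi bj; rewrite ltnn.
rewrite /vjoin IH //; suff -> : lv k (w n) (b n) x = 0 by rewrite maxn0.
apply: contrapT => /lv_nz bn.
by have := sep jn bj bn; rewrite ltnn.
Qed.

Lemma val_nz w n x : val w n x <> 0 -> exists j, [/\ j < n, b j x <> 0
  & val w n x = lv k (w j) (b j) x].
Proof.
move=> v0; have [[j [jn bj]]|nex] := pselect (exists j, j < n /\ b j x <> 0).
  by exists j; split=> //; apply: val_in.
case: v0; apply: val_out => j jn; apply: contrapT => bj; apply: nex.
by exists j.
Qed.

Lemma val_le w n x : word w -> val w n x <= k.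
Proof.
move=> wk; have [-> //|/eqP /val_nz [j [_ _ ->]]] := eqVneq (val w n x) 0.
exact: leq_trans (lv_le _ _ (wk j)) (wk j).
Qed.

Lemma val_finite w n : exists N, forall m, N <= m -> val w n m = 0.
Proof.
elim: n => [|n [N hN]]; first by exists 0.
have [_ [M hM] _] := fb n; exists (maxn N M) => m h /=; rewrite /vjoin.
by rewrite /lv /tetris hN ?hM //; lia.
Qed.

Lemma val_agree w w' n x : (forall i, i < n -> b i x <> 0 -> w i = w' i) ->
  val w n x = val w' n x.
Proof.
move=> ww; have [[j [jn bj]]|nex] := pselect (exists j, j < n /\ b j x <> 0).
  by rewrite !(val_in _ jn bj) ww.
have h j : j < n -> b j x = 0.
  by move=> jn; apply: contrapT => bj; apply: nex; exists j.
by rewrite !val_out.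
Qed.

Lemma val_peak w n j : word w -> j < n -> 0 < w j ->
  exists2 x, b j x <> 0 & val w n x = w j.
Proof.
move=> wk jn wj; have [x e h] := peak j; have bx : b j x <> 0 by have := wk j; lia.
by exists x => //; rewrite (val_in _ jn bx) h.
Qed.

Lemma lev_le_pm w n j x y : word w -> j < n -> b j y <> 0 -> y <= x ->
  lev w 0 j <= pm (val w n) x.
Proof.
move=> wk jn bj yx; have [-> //|] := posnP (lev w 0 j) => l0.
have [i ij wi] := lev_attained l0; rewrite -wi in l0 *.
have [|z bz <-] := @val_peak w n i wk _ l0; first by lia.
apply: le_smax => /=; first exact: val_le.
have ij' : i < j by lia.
by have := sep ij' bz bj; lia.
Qed.

Lemma lev_le_sm w n j x y : word w -> b j y <> 0 -> x <= y ->
  lev w j.+1 n <= sm (val w n) x.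
Proof.
move=> wk bj yx; have [-> //|] := posnP (lev w j.+1 n) => l0.
have [i ij wi] := lev_attained l0; rewrite -wi in l0 *.
have [|z bz <-] := @val_peak w n i wk _ l0; first by lia.
apply: le_smax => /=; first exact: val_le.
have ji : j < i by lia.
by have := sep ji bj bz; lia.
Qed.

Lemma pm_le w n j x c : word w -> c <= k -> b j x <> 0 -> lev w 0 j <= c ->
  (forall y, y < x -> b j y <> 0 -> lv k (w j) (b j) y <= c) -> pm (val w n) x <= c.
Proof.
move=> wk ck bj lc jc; have [-> //|] := posnP (pm (val w n) x).
move=> /smax_attained [y [yx e]]; rewrite /= in yx; rewrite {1}/pm -e.
have [-> //|/eqP /val_nz [i [_ bi ->]]] := eqVneq (val w n y) 0.
have [ij|ji|ie] := ltngtP i j.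
- by apply: leq_trans (lv_le _ _ (wk i)) _; apply: leq_trans lc; apply: lev_ge.
- by have := sep ji bj bi; lia.
- by rewrite ie in bi *; apply: jc.
Qed.

Lemma sm_le w n j x c : word w -> c <= k -> b j x <> 0 -> lev w j.+1 n <= c ->
  (forall y, x < y -> b j y <> 0 -> lv k (w j) (b j) y <= c) -> sm (val w n) x <= c.
Proof.
move=> wk ck bj lc jc; have [-> //|] := posnP (sm (val w n) x).
move=> /smax_attained [y [yx e]]; rewrite /= in yx; rewrite {1}/sm -e.
have [-> //|/eqP /val_nz [i [jn bi ->]]] := eqVneq (val w n y) 0.
have [ij|ji|ie] := ltngtP i j.
- by have := sep ij bi bj; lia.
- apply: leq_trans (lv_le _ _ (wk i)) _; apply: leq_trans lc; apply: lev_ge; lia.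
- by rewrite ie in bi *; apply: jc.
Qed.

Section Deletion.
Variables (th : nat -> nat -> nat) (w : nat -> nat) (n j : nat).
Hypothesis th_left : forall a a', a <= a' -> a' <= k -> a' < th a k -> th a' k = th a k.
Hypothesis th_right : forall c c', c <= c' -> c' <= k -> c' < th k c -> th k c' = th k c.
Hypothesis wk : word w.
Hypothesis jn : j < n.
Hypothesis wj : w j <> 0.
Hypothesis kk : lev w 0 j = k \/ lev w j.+1 n = k.
Hypothesis lt : w j < th (lev w 0 j) (lev w j.+1 n).
Hypothesis k0 : 0 < k.
Let w' := upd w j 0.
Hypothesis st : stair k (val w' n).

Let wk' : word w'.
Proof. exact: word_upd. Qed.

Let off x : b j x = 0 -> val w n x = val w' n x.
Proof.
move=> bx; apply: val_agree => i _ bi; rewrite /w' upd_neq // => e.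
by rewrite e in bi.
Qed.

Let on x : b j x <> 0 -> val w' n x = 0.
Proof.
move=> bx; rewrite (val_in _ jn bx) /w' upd_eq /lv /tetris.
by have [bk _ _] := fb j; have := bk x; lia.
Qed.

Let smax_delete P : (forall y, b j y <> 0 -> P y) ->
  smax k P (val w n) = maxn (smax k P (val w' n)) (w j).
Proof.
move=> bP; apply: smaxP; last 1 first.
- move=> m0; have [le|lt'] := leqP (w j) (smax k P (val w' n)).
    have m1 : 0 < smax k P (val w' n) by lia.
    have [y [Py e]] := smax_attained m1.
    exists y; split=> //; rewrite -e off //; apply: contrapT => /on.
    by move: m1; rewrite -e; lia.
  have [|y by_ e] := @val_peak w n j wk jn; first by lia.
  by exists y; split; [exact: bP|by []].
- move=> y Py; have [by0|/eqP by0] := eqVneq (b j y) 0.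
    by rewrite off // leq_max le_smax //; exact: val_le.
  by rewrite (val_in _ jn by0) leq_max lv_le ?orbT.
- by rewrite geq_max smax_le wk.
Qed.

(** The deleted block shows only values up to [w j], below the thresholds there. At other positions
    the threshold is unchanged; the stair property of the shortened word provides the level k that
    this requires. *)
Lemma visible_delete : visible_map k th (val w n) = visible_map k th (val w' n).
Proof.
apply/funext => x; rewrite /visible_map.
have [bx|/eqP bx] := eqVneq (b j x) 0; last first.
  rewrite (on bx); set v := if _ then 0 else 0; have -> : v = 0 by rewrite /v; case: ifP.
  case: ifP => // vis; have sx : val w n x <= w j by rewrite (val_in _ jn bx) lv_le.
  suff : w j < th (pm (val w n) x) (sm (val w n) x) by lia.
  apply: (th_inside th_left th_right kk lt); try exact: smax_le.
  - exact: (lev_le_pm _ jn bx).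
  - exact: (lev_le_sm _ _ bx).
  - apply: (@pm_le _ _ j) => //.
    + by rewrite geq_max (lev_le _ _ wk) wk.
    + exact: leq_maxl.
    + by move=> y _ _; rewrite leq_max lv_le ?orbT.
  - apply: (@sm_le _ _ j) => //.
    + by rewrite geq_max (lev_le _ _ wk) wk.
    + exact: leq_maxl.
    + by move=> y _ _; rewrite leq_max lv_le ?orbT.
rewrite (off bx); have [->|/eqP nz] := eqVneq (val w' n x) 0; first by do 2 case: ifP.
suff -> : th (pm (val w n) x) (sm (val w n) x) = th (pm (val w' n) x) (sm (val w' n) x) by [].
have [i [in_ bi _]] := val_nz nz.
have ij : i <> j by move=> e; rewrite e in bi.
have [lij|lij|//] := ltngtP i j.
  have -> : pm (val w n) x = pm (val w' n) x.
    apply: eq_smax => y /= yx; apply: off; apply: contrapT => by_.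
    by have := sep lij bi by_; lia.
  rewrite /sm smax_delete; last by move=> y by_; apply: sep bi by_.
  apply: (th_before th_right kk lt) => //; [exact: smax_le| |exact: stair_max].
  rewrite -(@lev_upd_out w j 0 j.+1 n) ?ltnn //.
  have [y by_ _] := peak j; have yn : b j y <> 0 by lia.
  by apply: (lev_le_sm _ _ yn) => //; apply/ltnW/(sep lij bi yn).
have -> : sm (val w n) x = sm (val w' n) x.
  apply: eq_smax => y /= yx; apply: off; apply: contrapT => by_.
  by have := sep lij by_ bi; lia.
rewrite /pm smax_delete; last by move=> y by_; apply: sep by_ bi.
apply: (th_after th_left kk lt) => //; [exact: smax_le| |exact: stair_max].
rewrite -(@lev_upd_out w j 0 0 j) ?ltnn ?andbF //.
have [y by_ _] := peak j; have yn : b j y <> 0 by lia.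
by apply: (lev_le_pm _ jn yn) => //; apply/ltnW/(sep lij yn bi).
Qed.

End Deletion.
End Blocks.

(** * Generic vectors are staircases *)

Section TowerStair.
Variables (k : nat) (U : set_system vec).
Hypothesis tU : gowers k U.
Local Notation "x |v| y" := (vjoin x y) (at level 50, left associativity).
Local Notation lv := (lv k).
#[local] Instance stair_ultra : UltraFilter U := gowers_ultra tU.

(** The position is a peak of the middle vector. *)
Lemma stair_point x1 x2 x3 N1 N2 c d l : fin k x1 -> fin k x2 -> fin k x3 ->
  (forall m, N1 <= m -> x1 m = 0) -> beyond N1 x2 ->
  (forall m, N2 <= m -> x2 m = 0) -> beyond N2 x3 ->
  0 < k -> l <= c -> l <= d -> c <= k -> d <= k ->
  let s := lv c x1 |v| (lv l x2 |v| lv d x3) in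
  exists p, [/\ pm k s p = c, sm k s p = d & s p = l].
Proof.
move=> [k1 _ [p1 e1]] [k2 _ [p2 e2]] [k3 _ [p3 e3]] b1 b2 b3 b4 k0 lc ld ck dk s.
have p1N : p1 < N1 by rewrite ltnNge; apply/negP => /b1; lia.
have p2N : N1 <= p2 by rewrite leqNgt; apply/negP => /b2; lia.
have p2N' : p2 < N2 by rewrite ltnNge; apply/negP => /b3; lia.
have p3N : N2 <= p3 by rewrite leqNgt; apply/negP => /b4; lia.
exists p2; split.
- apply: smaxP => //.
    move=> y /= yp; rewrite /s /vjoin /lv /tetris (b4 y) ?(leq_trans yp) //; last by lia.
    by have := k1 y; have := k2 y; lia.
  move=> _; exists p1; split; first by rewrite /=; lia.
  by rewrite /s /vjoin /lv /tetris (b2 p1) // (b4 p1) ?e1; lia.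
- apply: smaxP => //.
    move=> y /= yp; rewrite /s /vjoin /lv /tetris (b1 y); last by lia.
    by have := k2 y; have := k3 y; lia.
  move=> _; exists p3; split; first by rewrite /=; lia.
  by rewrite /s /vjoin /lv /tetris (b1 p3) ?(b3 p3) ?e3; lia.
- by rewrite /s /vjoin /lv /tetris (b1 p2) // (b4 p2) // e2; lia.
Qed.

Lemma gowers_point c d l : 0 < k -> c <= k -> d <= k -> c = k \/ d = k ->
  l <= c -> l <= d ->
  U (fun x => exists p, [/\ pm k x p = c, sm k x p = d & x p = l]).
Proof.
move=> k0 ck dk cd lc ld; pose Q x := exists p, [/\ pm k x p = c, sm k x p = d & x p = l].
have lvk x : lv k x = x by rewrite /lv subnn tetris0.
suff : U (fun x1 => U (fun x2 => U (fun x3 => Q (lv c x1 |v| (lv l x2 |v| lv d x3))))).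
  rewrite -[X in _ -> X]/(U (fun x => Q x)) (_ : (fun x => Q x) = fun x => Q (lv k x)); last first.
    by apply/funext => x; rewrite lvk.
  (* The letter k first gives off the other outer letter; the right-hand letter then gives off the
     middle one, at level l. *)
  case: cd => [ec|ed].
    rewrite ec (split_after tU Q dk (leqnn k)); apply: filterS => x1.
    by rewrite (split_before tU (fun X => Q (lv k x1 |v| X)) ld dk).
  rewrite ed (split_before tU Q ck (leqnn k)); apply: filterS => x1.
  by rewrite (split_before tU (fun X => Q (lv c x1 |v| X)) (leq_trans ld dk) (leqnn k)).
have [_ fU bU _] := tU; apply: (@filterS _ U _ _ _ _ fU) => x1 f1.
have [_ [N1 b1] _] := f1.
apply: (@filterS _ U _ _ _ _ (filterI fU (bU N1))) => x2 [f2 b2].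
have [_ [N2 b3] _] := f2.
apply: (@filterS _ U _ _ _ _ (filterI fU (bU N2))) => x3 [f3 b4].
exact: (stair_point f1 f2 f3 b1 b2 b3 b4).
Qed.

Lemma gowers_stair : 0 < k -> U (stair k).
Proof.
move=> k0.
have : U (fun x => forall a l : 'I_k.+1, 0 < a -> l <= a ->
    (exists p, [/\ pm k x p = a, sm k x p = k & x p = l]) /\
    (exists p, [/\ pm k x p = k, sm k x p = a & x p = l])).
  apply: filter_forall => a; apply: filter_forall => l.
  have [a0|] := posnP a; first by apply: filterE => x.
  have [la a0|] := leqP l a; last by move=> *; exact: filterE.
  have ak : a <= k by rewrite -ltnS.
  have h1 := gowers_point k0 ak (leqnn k) (or_intror erefl) la (leq_trans la ak).
  have h2 := gowers_point k0 (leqnn k) ak (or_introl erefl) (leq_trans la ak) la.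
  by move: h1 h2; apply: filterS2.
apply: filterS => x h a l a0 ak la.
have lk : l < k.+1 by lia.
exact: (h (Ordinal (ak : a < k.+1)) (Ordinal lk)).
Qed.

End TowerStair.

(** * Reduced words and the visible map *)

Section Final.
Variables (k : nat) (U : set_system vec).
Hypothesis k0 : 0 < k.
Hypothesis tU : gowers k U.
Variable R : vec -> vec -> Prop.
Hypothesis Rrefl : forall u, R u u.
Hypothesis Rsym : forall u v, R u v -> R v u.
Hypothesis Rtrans : forall u v w, R u v -> R v w -> R u w.
Variable b : nat -> vec.
Hypothesis gb :
  generic k U (fun c : bool => if c then R else fun u _ => stair k u) k.+4 b.

Local Notation val := (val k b).
Local Notation word := (word k).
Local Notation thr := (thr k U R).
Local Notation full := (full k).
Local Notation reduced := (reduced k U R).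
Local Notation deletable := (deletable k U R).
Local Notation siblings := (siblings k U R).
Local Notation vis w n := (visible_map k thr (val w n)).
#[local] Instance final_ultra : UltraFilter U := gowers_ultra tU.

Let fb n : fin k (b n).
Proof. by have [] := gb. Qed.

Let sep i j : i < j -> forall m m', b i m <> 0 -> b j m' <> 0 -> m < m'.
Proof. by have [_ h _] := gb; apply: h. Qed.

Let th_left a a' : a <= a' -> a' <= k -> a' < thr a k -> thr a' k = thr a k.
Proof. exact: (thr_persist_left tU Rsym Rtrans). Qed.

Let th_right c c' : c <= c' -> c' <= k -> c' < thr k c -> thr k c' = thr k c.
Proof. exact: (thr_persist_right tU Rsym Rtrans). Qed.

(** Here the second relation of the generic sequence is used: the word is pulled back to the empty
    word, which leaves one generic letter k. *)
Lemma full_stair w n : word w -> full w n -> stair k (val w n).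
Proof.
move=> wk wn; have := @pat_common _ _ tU _ _ _ gb false 0 0 n w w [::] wk wk.
rewrite add0n max0n wn /= step0 //; case=> //.
move=> _; apply; apply: (@filterS _ U _ _ _ _ (gowers_stair tU k0)) => x st.
suff -> : vjoin (fun=> 0) (lv k k x) = x by [].
by apply/funext => y; rewrite /vjoin /lv /tetris; lia.
Qed.

Lemma vis_deletable w n j : word w -> deletable w j n ->
  vis w n = vis (upd w j 0) n.
Proof.
move=> wk dj; have [jn wj kk lt] := dj.
apply: (visible_delete fb sep th_left th_right wk jn wj kk lt k0).
apply: full_stair; first exact: word_upd.
by apply: (deletable_full wk dj).
Qed.

Lemma vis_neq0 w n x : vis w n x <> 0 -> vis w n x = val w n x.
Proof. by rewrite /visible_map; case: ifP. Qed.

(** The witness is the first position of block j whose value reaches the threshold. Earlier values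
    of the block lie below it, so by persistence the running maximum still has the threshold of
    [lev w 0 j]. *)
Lemma visible_first w n j : word w -> full w n -> j < n ->
  lev w j.+1 n = k \/ lev w 0 j < k -> thr (lev w 0 j) k <= w j ->
  exists2 x, b j x <> 0 & vis w n x <> 0.
Proof.
move=> wk wn jn kk le; have lk := lev_le 0 j wk; have st := full_stair wk wn.
have t0 : 0 < thr (lev w 0 j) k by apply: (thr_gt0 tU) => //; apply/maxn_idPr.
have ex : exists x, (b j x != 0) && (thr (lev w 0 j) k <= lv k (w j) (b j) x).
  have [x e h] := peak fb j; exists x; rewrite h // le andbT e; lia.
have [x /andP[/eqP bx xt] xmin] := ex_minnP ex; exists x => //.
have vx : val w n x = lv k (w j) (b j) x by exact: val_in.
have p1 : lev w 0 j <= pm k (val w n) x by exact: (lev_le_pm fb sep wk jn bx).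
have p2 : pm k (val w n) x <= maxn (lev w 0 j) (thr (lev w 0 j) k).-1.
  have wjk := wk j.
  apply: (pm_le fb sep n wk _ bx); [lia|lia|].
  move=> y yx by_; rewrite leq_max; apply/orP; right.
  have := xmin y; rewrite (introN eqP by_) /=; lia.
have pk : pm k (val w n) x <= k by exact: smax_le.
have e1 : thr (pm k (val w n) x) k = thr (lev w 0 j) k.
  by have [-> //|ne] := eqVneq (pm k (val w n) x) (lev w 0 j); apply: th_left => //; lia.
have e2 : sm k (val w n) x = k.
  case: kk => [sk|pk'].
    have := lev_le_sm fb sep n wk bx (leqnn x); have : sm k (val w n) x <= k by exact: smax_le.
    by rewrite sk; lia.
  by have wjk := wk j; case: (stair_max x k0 st) => // e; lia.
rewrite /visible_map e2 e1 vx xt; lia.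
Qed.

Lemma visible_last w n j : word w -> full w n -> j < n ->
  lev w 0 j = k \/ lev w j.+1 n < k -> thr k (lev w j.+1 n) <= w j ->
  exists2 x, b j x <> 0 & vis w n x <> 0.
Proof.
move=> wk wn jn kk le; have lk := lev_le j.+1 n wk; have st := full_stair wk wn.
set c := lev w j.+1 n in kk le lk.
have t0 : 0 < thr k c by apply: (thr_gt0 tU) => //; apply/maxn_idPl.
have ex : exists x, (b j x != 0) && (thr k c <= lv k (w j) (b j) x).
  have [x e h] := peak fb j; exists x; rewrite h // le andbT e; lia.
have [_ [N hN] _] := fb j.
have bd x : (b j x != 0) && (thr k c <= lv k (w j) (b j) x) -> x <= N.
  by move=> /andP[/eqP bx _]; rewrite leqNgt; apply/negP => /ltnW /hN.
have [x /andP[/eqP bx xt] xmax] := ex_maxnP ex bd; exists x => //.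
have vx : val w n x = lv k (w j) (b j) x by exact: val_in.
have p1 : c <= sm k (val w n) x by exact: (lev_le_sm fb sep n wk bx).
have p2 : sm k (val w n) x <= maxn c (thr k c).-1.
  have wjk := wk j.
  apply: (sm_le fb sep wk _ bx); [lia|rewrite -/c; lia|].
  move=> y yx by_; rewrite leq_max; apply/orP; right.
  have := xmax y; rewrite (introN eqP by_) /=; lia.
have pk : sm k (val w n) x <= k by exact: smax_le.
have e1 : thr k (sm k (val w n) x) = thr k c.
  by have [-> //|ne] := eqVneq (sm k (val w n) x) c; apply: th_right => //; lia.
have e2 : pm k (val w n) x = k.
  case: kk => [sk|pk'].
    have := lev_le_pm fb sep wk jn bx (leqnn x); have : pm k (val w n) x <= k by exact: smax_le.
    by rewrite sk; lia.
  by have wjk := wk j; case: (stair_max x k0 st) => // e; lia.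
rewrite /visible_map e2 e1 vx xt; lia.
Qed.

(** The only letter k of the word: negligible as soon as another k stands on either side, but not
    deletable. *)
Definition floating w n j := [/\ w j = k, lev w 0 j < k, lev w j.+1 n < k,
  k < thr (lev w 0 j) k & k < thr k (lev w j.+1 n)].

Lemma visible_or_floating w n j : word w -> full w n -> reduced w n -> j < n ->
  w j <> 0 -> (exists2 x, b j x <> 0 & vis w n x <> 0) \/ floating w n j.
Proof.
move=> wk wn rw jn wj.
have lk := lev_le 0 j wk; have lk' := lev_le j.+1 n wk.
have [s|s] := eqVneq (lev w j.+1 n) k.
  left; apply: visible_first => //; first by left.
  by have := reduced_letter wk rw jn wj (or_intror s); rewrite s.
have [p|p] := eqVneq (lev w 0 j) k.
  left; apply: visible_last => //; first by left.
  by have := reduced_letter wk rw jn wj (or_introl p); rewrite p.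
have wjk : w j = k by move: wn; rewrite /full (lev_around _ jn); have := wk j; lia.
have [h1|h1] := leqP (thr (lev w 0 j) k) k.
  by left; apply: visible_first => //; [right; lia|rewrite wjk].
have [h2|h2] := leqP (thr k (lev w j.+1 n)) k.
  by left; apply: visible_last => //; [right; lia|rewrite wjk].
by right; split=> //; lia.
Qed.

Lemma visible_letter w w' n j x : j < n -> b j x <> 0 -> vis w n x <> 0 ->
  vis w n = vis w' n -> word w -> word w' -> w j = w' j.
Proof.
move=> jn bx v e wk wk'; have v' : vis w' n x <> 0 by rewrite -e.
have := congr1 (fun f => f x) e; rewrite /= (vis_neq0 v) (vis_neq0 v').
have := v; rewrite (vis_neq0 v) !(val_in _ sep _ jn bx) /lv /tetris.
by have := wk j; have := wk' j; lia.
Qed.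

Lemma floating_unique w n j i : word w -> floating w n j -> i < n -> w i = k -> i = j.
Proof.
move=> wk [_ p s _ _] in_ wi; apply: contrapT => ij.
have [h1|h1|//] := ltngtP i j.
  by have := @lev_ge w 0 j i; lia.
by have := @lev_ge w j.+1 n i; lia.
Qed.

(** Visible positions fix their letters, so the words differ only at floating letters, at j in w and
    at some i in w'. Their common parent has a k in both places. *)
Lemma same_visible_floating w w' n j : word w -> word w' -> full w n -> full w' n ->
  reduced w n -> reduced w' n -> vis w n = vis w' n -> j < n -> w j <> w' j ->
  w j <> 0 -> siblings w w' n.
Proof.
move=> wk wk' wn wn' rw rw' e jn ww wj.
have eqw l : l < n -> w l <> 0 -> w l <> w' l -> floating w n l.
  move=> ln wl ne; have [[x bx vx]|//] := visible_or_floating wk wn rw ln wl.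
  by case: ne; apply: visible_letter vx e wk wk'.
have eqw' l : l < n -> w' l <> 0 -> w l <> w' l -> floating w' n l.
  move=> ln wl ne; have [[x bx vx]|//] := visible_or_floating wk' wn' rw' ln wl.
  by case: ne; apply/esym; apply: visible_letter vx (esym e) wk' wk.
have fj := eqw j jn wj ww; have [wjk pj sj tpj tsj] := fj.
have [|i in_ wi] := @lev_attained w' 0 n; first by rewrite wn'.
rewrite wn' in wi; have {}in_ : i < n by lia.
have ij : i <> j by move=> ij; rewrite ij in wi; rewrite wi wjk in ww.
have wik : w i <> k by move=> h; apply: ij; apply: (floating_unique wk fj in_ h).
have fi : floating w' n i by apply: eqw'; rewrite ?wi //; lia.
have [_ pi si tpi tsi] := fi.
have wi0 : w i = 0.
  apply: contrapT => h; apply: (wik).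
  by have [] : floating w n i by apply: eqw; rewrite ?wi.
have wj0 : w' j = 0.
  apply: contrapT => h; have fj' : floating w' n j by apply: eqw'.
  by apply: ww; rewrite wjk; have [] := fj'.
have oth l : l < n -> l <> i -> l <> j -> w l = w' l.
  move=> ln li lj; apply: contrapT => ne.
  have [z|/eqP z] := eqVneq (w l) 0.
    have fl : floating w' n l by apply: eqw' => //; rewrite -z => h; apply: ne.
    by apply: (li); apply: (floating_unique wk' fi ln); have [] := fl.
  have fl : floating w n l by apply: eqw.
  by apply: lj; apply: (floating_unique wk fj ln); have [] := fl.
have xk : word (upd w i k) by apply: word_upd.
have xj : upd w i k j = k by rewrite upd_neq //; apply: nesym.
have xi : upd w i k i = k by rewrite upd_eq.
have level p q l : p <= l < q -> upd w i k l = k -> lev (upd w i k) p q = k.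
  by move=> pq h; have := lev_le p q xk; have := lev_ge (upd w i k) pq; rewrite h; lia.
exists (upd w i k), i, j; split; first split=> //.
- by apply: (level _ _ j).
- have [lij|lji|//] := ltngtP i j.
    have s : lev (upd w i k) i.+1 n = k by apply: (level _ _ j); rewrite ?xj //; lia.
    have p : lev (upd w i k) 0 i = lev w' 0 i.
      by rewrite lev_upd_out ?ltnn ?andbF //; apply: eq_lev => l hl; apply: oth; lia.
    by split; rewrite ?s ?p ?xi //; [lia|right].
  have p : lev (upd w i k) 0 i = k by apply: (level _ _ j); rewrite ?xj //; lia.
  have s : lev (upd w i k) i.+1 n = lev w' i.+1 n.
    by rewrite lev_upd_out ?ltnn //; apply: eq_lev => l hl; apply: oth; lia.
  by split; rewrite ?s ?p ?xi //; [lia|left].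
- have [lji|lij|//] := ltngtP j i; last by move=> h; case: ij.
    have s : lev (upd w i k) j.+1 n = k by apply: (level _ _ i); rewrite ?xi //; lia.
    have p : lev (upd w i k) 0 j = lev w 0 j by rewrite lev_upd_out //; lia.
    by split; rewrite ?s ?p ?xj //; [lia|right].
  have p : lev (upd w i k) 0 j = k by apply: (level _ _ i); rewrite ?xi //; lia.
  have s : lev (upd w i k) j.+1 n = lev w j.+1 n by rewrite lev_upd_out //; lia.
  by split; rewrite ?s ?p ?xj //; [lia|left].
- move=> l ln; have [->|/eqP li] := eqVneq l i; first by rewrite upd_eq.
  by rewrite !upd_neq.
- move=> l ln; have [->|/eqP lj] := eqVneq l j; first by rewrite upd_eq.
  have [->|/eqP li] := eqVneq l i; first by rewrite upd_neq // xi.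
  by rewrite !upd_neq // oth.
Qed.

Lemma same_visible w w' n : word w -> word w' -> full w n -> full w' n ->
  reduced w n -> reduced w' n -> vis w n = vis w' n ->
  (forall j, j < n -> w j = w' j) \/ siblings w w' n.
Proof.
move=> wk wk' wn wn' rw rw' e.
have [|[j [jn ww _]]] := last_difference w w' n; first by left.
right; have [wj|/eqP wj] := eqVneq (w j) 0; last exact: (same_visible_floating wk wk' wn wn' rw rw' e jn ww wj).
apply: siblings_sym; apply: (@same_visible_floating _ _ _ j) => //.
  by apply: nesym.
by rewrite -wj => h; apply: ww.
Qed.

Lemma rel_vis w w' n : word w -> word w' -> full w n -> full w' n ->
  R (val w n) (val w' n) <-> vis w n = vis w' n.
Proof.
move=> wk wk' wn wn'.
have red x : word x -> full x n -> exists y,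
    [/\ word y, full y n, reduced y n, R (val x n) (val y n) & vis x n = vis y n].
  move=> xk xn; have [y [yk yn ry yP]] := reduction_exists U R xk xn.
  have [h1 h2] : R (val x n) (val y n) /\ vis x n = vis y n.
    apply: (yP (fun z => R (val x n) (val z n) /\ vis x n = vis z n)); first by split.
    move=> z j zk zn dj [h1 h2]; split.
      by apply: Rtrans h1 _; apply: (deletable_rel tU Rsym Rtrans gb zk dj).
    by rewrite h2; apply: vis_deletable.
  by exists y.
have ev x y : (forall l, l < n -> x l = y l) -> val x n = val y n.
  by move=> xy; apply: eq_val.
have sib x y : siblings x y n -> R (val x n) (val y n) /\ vis x n = vis y n.
  move=> [z [i [j [[zk zn di dj] zi zj]]]].
  rewrite -(ev _ _ zi) -(ev _ _ zj) -!vis_deletable //; split=> //.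
  have h1 := deletable_rel tU Rsym Rtrans gb zk di.
  have h2 := deletable_rel tU Rsym Rtrans gb zk dj.
  by apply: Rtrans (Rsym h1) h2.
have [y [yk yn ry Rxy vxy]] := red w wk wn.
have [y' [yk' yn' ry' Rxy' vxy']] := red w' wk' wn'.
split=> [h|].
  have h' : R (val y n) (val y' n) by apply: Rtrans (Rsym Rxy) (Rtrans h Rxy').
  rewrite vxy vxy'.
  have [/ev -> //|/sib [] //] := related_reduced tU Rrefl Rsym Rtrans gb k0 yk yk' yn yn' ry ry' h'.
rewrite vxy vxy' => e; apply: Rtrans Rxy (Rtrans _ (Rsym Rxy')).
by have [/ev -> //|/sib [] //] := same_visible yk yk' yn yn' ry ry' e.
Qed.

End Final.

(** * From spans to words *)

Section Span.
Variables (k : nat) (b : nat -> vec).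
Hypothesis fb : forall n, fin k (b n).
Hypothesis sep : forall i j, i < j -> forall m m', b i m <> 0 -> b j m' <> 0 -> m < m'.

(** All large lengths n are offered so that two vectors can be written as words of the same
    length. *)
Lemma span_val s : span k b s ->
  exists w m, word k w /\ forall n, m <= n -> full k w n /\ s = val k b w n.
Proof.
move=> [e [_ /allP ek0 /hasP [p0 p0e /eqP p00] ->]].
(* The operation T^i of the span is [lv] at level k - i; an index without a pair gets the letter
   0. *)
pose w j := \max_(p <- e | p.1 == j) (k - p.2).
pose m := (\max_(p <- e) p.1).+1.
have ek p : p \in e -> p.2 <= k by move=> pe; apply: ek0.
have wk : word k w by move=> j; apply/bigmax_leqP_seq => p _ _; apply: leq_subr.
have we p : p \in e -> k - p.2 <= w p.1 by move=> pe; apply: leq_bigmax_seq => /=.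
have wa j : 0 < w j -> exists p, [/\ p \in e, p.1 = j & w j = k - p.2].
  rewrite /w; elim: (e) => [|q r IH]; first by rewrite big_nil.
  rewrite big_cons; have up : (exists p, [/\ p \in r, p.1 = j &
      \max_(p <- r | p.1 == j) (k - p.2) = k - p.2]) ->
    exists p, [/\ p \in q :: r, p.1 = j & \max_(p <- r | p.1 == j) (k - p.2) = k - p.2].
    by move=> [p [pr pj h]]; exists p; rewrite inE pr orbT.
  case: eqP => [qj|_]; last by move=> /IH /up.
  case: (leqP (k - q.2) (\max_(p <- r | p.1 == j) (k - p.2))) => _; first by move=> /IH /up.
  by move=> _; exists q; rewrite inE eqxx.
exists w, m; split=> // n mn.
have ne p : p \in e -> p.1 < n.
  by move=> pe; apply: leq_trans mn; rewrite ltnS; apply: leq_bigmax_seq.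
split.
  have := lev_le 0 n wk; have := we _ p0e; have := ne _ p0e => h.
  have := @lev_ge w 0 n p0.1 h; rewrite /full p00; lia.
apply/funext => x; apply/eqP; rewrite eqn_leq; apply/andP; split.
  apply/bigmax_leqP_seq => p pe _; have [z|/eqP bx] := eqVneq (b p.1 x) 0.
    by rewrite /tetris z.
  rewrite (val_in _ sep _ (ne _ pe) bx) /lv /tetris.
  by apply: leq_sub2l; rewrite leq_subCl; apply: we.
have [-> //|/eqP vx] := eqVneq (val k b w n x) 0.
have [j [jn bx ve]] := val_nz sep vx; rewrite ve.
have w0 : 0 < w j.
  rewrite lt0n; apply/eqP => w0; apply: vx; rewrite ve w0 /lv /tetris.
  by have [bk _ _] := fb j; have := bk x; lia.
have [p [pe pj wp]] := wa _ w0.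
apply: (@leq_trans (tetris p.2 (b p.1) x)); last by apply: leq_bigmax_seq.
by rewrite wp pj /lv /tetris; have := ek _ pe; lia.
Qed.

Lemma fin_FIN s : fin k s -> FIN k s.
Proof.
move=> [sk [N sN] [n e]]; split=> //; last by exists n.
apply: (@sub_finite_set _ _ `I_N); last exact: finite_II.
by move=> x /= sx; rewrite ltnNge; apply/negP => /sN.
Qed.

Lemma full_fin w n : 0 < k -> word k w -> full k w n -> fin k (val k b w n).
Proof.
move=> k0 wk wn; split; first by move=> x; apply: val_le.
  exact: val_finite.
have [|j jn wj] := @lev_attained w 0 n; first by rewrite wn.
have [||x _ e] := @val_peak k b fb sep w n j wk; [by lia|by rewrite wj wn|].
by exists x; rewrite e wj.
Qed.

Lemma blocks_block_seq : 0 < k -> block_seq k b.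
Proof.
move=> k0 n; split; first exact: fin_FIN.
have ex m : exists x, b m x != 0.
  by have [_ _ [x e]] := fb m; exists x; rewrite e; lia.
have [_ [N hN] _] := fb n.
have bd x : b n x != 0 -> x <= N.
  by move=> /eqP bx; rewrite leqNgt; apply/negP => /ltnW /hN.
have [y /eqP by_ ymax] := ex_maxnP (ex n) bd.
have [z /eqP bz zmin] := ex_minnP (ex n.+1).
rewrite /vec_lt (@maxsetE _ y) //; last by move=> x /eqP /ymax.
by rewrite (@minsetE _ z) //; [apply: (sep (ltnSn n))|move=> x /eqP /zmin].
Qed.

End Span.

Theorem theorem4p1 (k : nat) (hk : 1 <= k) (R : vec -> vec -> Prop)
    (hR : equivalence_on (FIN k) R) :
  exists B : nat -> vec,
    [/\ block_seq k B, sos_seq k B & staircase_rel k B R].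
Proof.
have [Rr Rs Rt] := hR.
(* R is made an equivalence relation on all of [vec]: the vectors outside FIN_k form one further
   class. *)
pose R' s t := (FIN k s <-> FIN k t) /\ (FIN k s -> FIN k t -> R s t).
have R'refl u : R' u u by split=> // fu _; apply: Rr.
have R'sym u v : R' u v -> R' v u.
  by move=> [h1 h2]; split; [exact: iff_sym|move=> fv fu; apply: Rs => //; apply: h2].
have R'trans u v w : R' u v -> R' v w -> R' u w.
  move=> [h1 h2] [h3 h4]; split; first exact: iff_trans h1 h3.
  by move=> fu fw; have fv := h1.1 fu; apply: (Rt u v w) => //; [exact: h2|exact: h4].
have [U tU] := gowers_exists k.
(* [k.+4] leaves room for a condensed tail of at most k + 1 pairs together with an inserted pair,
   and for the three pairs in [erase_level]. *)
have [b gb] := generic_exists tU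
  (fun c : bool => if c then R' else fun u _ => stair k u) k.+4.
have [fb sep _] := gb.
exists b; split; first exact: blocks_block_seq.
  move=> s /(span_val fb sep) [w [m [wk /(_ m (leqnn m)) [wn ->]]]].
  have [N hN] := val_finite fb w m.
  apply: (staircase_sos hk _ hN); first by move=> x; apply: val_le.
  exact: (full_stair hk tU gb).
exists (staircase_map k (thr k U R')).
  by exists (staircase_map k (thr k U R')) => //; exact: staircase_map_closure.
move=> s t /(span_val fb sep) [w [m [wk hw]]] /(span_val fb sep) [w' [m' [wk' hw']]].
have [wn ->] := hw _ (leq_maxl m m'); have [wn' ->] := hw' _ (leq_maxr m m').
set n := maxn m m' in wn wn' *.
have f : FIN k (val k b w n) by apply/fin_FIN/full_fin.
have f' : FIN k (val k b w' n) by apply/fin_FIN/full_fin.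
have [N hN] := val_finite fb w n; have [N' hN'] := val_finite fb w' n.
rewrite (staircase_mapE hk _ hN); [|by move=> x; apply: val_le|exact: (full_stair hk tU gb)].
rewrite (staircase_mapE hk _ hN'); [|by move=> x; apply: val_le|exact: (full_stair hk tU gb)].
rewrite -(rel_vis hk tU R'refl R'sym R'trans gb wk wk' wn wn').
by split=> [h|[_]]; [split|apply].
Qed.
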